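(* Let $\alpha\in(0,1)$ be a quadratic irrational number and let $\Omega_\alpha$ be the tiling space of the canonical projection from dimension $2$ to $1$ with slope $\alpha$. Then within the class of one-dimensional tiling spaces $\Omega_\beta$ ($\beta\in(0,1)$ irrational) that are strong orbit equivalent to $\Omega_\alpha$ there is a substitution tiling space.
   Context: Canonical projection tilings. Let $L_\alpha=\{y=\alpha x\}\subset\mathbb{R}^2$, let $\mathrm{pr}_1,\mathrm{pr}_2$ be the orthogonal projections of $\mathbb{R}^2$ onto $L_\alpha$ and $L_\alpha^\perp$, and let $W=\mathrm{pr}_2([0,1]^2)$. The points $\mathrm{pr}_1(y)$, $y\in\mathbb{Z}^2$ with $\mathrm{pr}_2(y)\in W$, where exactly one of $(0,1),(1,0)$ (which project to the endpoints of $W$) is kept, are the vertices of a tiling $T(\alpha)$ of $L_\alpha\cong\mathbb{R}$ by two tiles labelled $0,1$ of lengths $\frac{1}{\sqrt{1+\alpha^2}},\frac{\alpha}{\sqrt{1+\alpha^2}}$. Tiling metric: $T,T'$ are $\varepsilon$-close if there are $x,x'$ with $|x|,|x'|<\varepsilon/2$ such that $T+x$ and $T'+x'$ coincide on $B_{1/\varepsilon}(0)$. The hull $\Omega_T$ of a tiling $T$ is the completion of its translation orbit in this metric; $\Omega_\alpha=\Omega_{T(\alpha)}$. Sturmian spaces. For $\rho\in[0,1)$ let $s_n(\rho)=\lceil n\alpha+\rho\rceil-\lceil(n-1)\alpha+\rho\rceil\in\{0,1\}$, $n\in\mathbb{Z}$. The sturmian space associated with $\Omega_\alpha$ is $X_\alpha=\overline{\{(s_n(\rho))_{n\in\mathbb{Z}}:\rho\in[0,1)\}}\subset\{0,1\}^{\mathbb{Z}}$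 with the shift $\sigma(S)_i=s_{i+1}$. Two sturmian spaces $(X,\sigma),(Y,\sigma)$ are orbit equivalent if there is a homeomorphism $h:X\to Y$ mapping the $\sigma$-orbit of $x$ onto that of $h(x)$ for every $x$; then there is a unique cocycle $n:X\to\mathbb{Z}$ with $h(\sigma(x))=\sigma^{n(x)}(h(x))$. They are strong orbit equivalent if they are orbit equivalent and $n$ has at most one point of discontinuity. $\Omega_\alpha,\Omega_\beta$ are, by definition, strong orbit equivalent if $(X_\alpha,\sigma),(X_\beta,\sigma)$ are. Substitutions. A patch is a finite connected union of tiles. A substitution rule $\omega$ with linear factor $\lambda>1$ assigns to each proto-tile $\tau$ a patch of translated proto-tiles whose union is the stretched tile $\lambda\tau$; it is primitive if for some $N$ every proto-tile appears in the $N$-th iterate of every proto-tile. A substitution tiling space is the hull $\Omega_\omega$ associated with a primitive substitution rule $\omega$, i.e. the hull of any tiling generated by iterating $\omega$. *)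

(* Defs.v *)
From HB Require Import structures.
From mathcomp Require Import all_boot all_order all_algebra.
From mathcomp Require Import all_classical all_reals all_analysis.
From mathcomp Require Import lra.

Set Implicit Arguments.
Unset Strict Implicit.
Unset Printing Implicit Defensive.

Import Order.TTheory GRing.Theory Num.Theory numFieldNormedType.Exports.
Local Open Scope classical_set_scope.
Local Open Scope ring_scope.

Definition quadratic_irrational (R : realType) : set R :=
  [set x | irrational x /\
     exists a b c : int, a != 0 /\ a%:~R * x ^+ 2 + b%:~R * x + c%:~R = 0].

Section Homeomorphism.
Context {U V : topologicalType}.

Definition homeo_on (A : set U) (B : set V) (h : U -> V) : Prop :=
  exists g : V -> U,
    [/\ set_fun A B h, set_fun B A g,
        (forall x, A x -> g (h x) = x) /\ (forall y, B y -> h (g y) = y),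
        {within A, continuous h} & {within B, continuous g}].

End Homeomorphism.

(** * Tilings of the line *)

(* The proto-tiles are indexed by a finite type I of labels; the one labelled i
   is the interval [0, len i].  The pair (i, x) stands for its translate
   [x, x + len i]; a patch or a tiling is the set of its tiles. *)

Definition tileset (R : realType) (I : finType) (len : I -> R) : Type :=
  set (I * R).

HB.instance Definition _ (R : realType) (I : finType) (len : I -> R) :=
  gen_eqMixin (tileset len).
HB.instance Definition _ (R : realType) (I : finType) (len : I -> R) :=
  gen_choiceMixin (tileset len).

Section Tilings.
Context {R : realType} {I : finType} {len : I -> R}.
Implicit Types (T P : tileset len) (t : I * R) (x e r : R).

Definition support t : set R := `[t.2, t.2 + len t.1].

Definition nonoverlapping T : Prop :=
  forall t t', T t -> T t' -> t <> t' ->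
    `]t.2, t.2 + len t.1[ `&` `]t'.2, t'.2 + len t'.1[ = set0 :> set R.

Definition is_tiling T : Prop :=
  nonoverlapping T /\ \bigcup_(t in T) support t = setT.

Definition is_patch P : Prop :=
  [/\ finite_set P, nonoverlapping P & connected (\bigcup_(t in P) support t)].

Definition translate T x : tileset len := [set (t.1, t.2 + x) | t in T].

Definition coincide_on (B : set R) T T' : Prop :=
  forall t, support t `&` B !=set0 -> (T t <-> T' t).

Definition close e T T' : Prop :=
  exists x x' : R, [/\ `|x| < e / 2, `|x'| < e / 2 &
    coincide_on (ball (0 : R) e^-1) (translate T x) (translate T' x')].

Lemma translateP T x t : translate T x t <-> T (t.1, t.2 - x).
Proof.
split=> [[[i y] /= Ty <-]|]; first by rewrite /= addrK.
by move=> Tt; exists (t.1, t.2 - x) => //=; rewrite subrK; case: t {Tt}.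
Qed.

Lemma supportB t x y : support t y -> support (t.1, t.2 - x) (y - x).
Proof.
by rewrite /support /= !in_itv /= => /andP[? ?]; apply/andP; split; lra.
Qed.

Lemma close_refl e T : 0 < e -> close e T T.
Proof. by move=> e0; exists 0, 0; rewrite normr0 divr_gt0. Qed.

Lemma close_sym e T T' : close e T T' -> close e T' T.
Proof.
move=> [x [x' [xe x'e TT']]]; exists x', x; split=> // t /TT' h.
by split=> /h.
Qed.

Lemma close_le e e' T T' : 0 < e -> e <= e' -> close e T T' -> close e' T T'.
Proof.
move=> e0 ee' [x [x' [xe x'e TT']]].
exists x, x'; split; [by lra|by lra|move=> t [y [ty yB]]; apply: TT'].
exists y; split=> //; apply: le_ball yB.
by rewrite lef_pV2 ?posrE //; lra.
Qed.

Lemma close_split e T1 T2 T3 : 0 < e ->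
  let d := Num.min (e / 3) (1 / 2) in close d T1 T2 -> close d T2 T3 ->
  close e T1 T3.
Proof.
move=> e0 d.
have de : d <= e / 3 by rewrite /d ge_min lexx.
have d2 : d <= 1 / 2 by rewrite /d ge_min lexx orbT.
have d0 : 0 < d by rewrite /d lt_min; apply/andP; split; lra.
clearbody d.
move=> [x [x' [xd x'd T12]]] [y [y' [yd y'd T23]]].
have ed : e^-1 + d <= d^-1.
  have : e^-1 <= d^-1 / 3.
    by rewrite -invfM lef_pV2 ?posrE ?mulr_gt0 //; lra.
  have : 2 <= d^-1.
    by rewrite -(invrK (2 : R)) lef_pV2 ?posrE ?invr_gt0 //; lra.
  by lra.
have xyd : `|y - x'| < d by apply: le_lt_trans (ler_normB _ _) _; lra.
exists (x + (y - x')), y'; split=> [||t].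
- by apply: le_lt_trans (ler_normD _ _) _; lra.
- by lra.
move=> [z [tz]]; rewrite -ball_normE /= sub0r normrN => ze.
have {}T23 : translate T2 y t <-> translate T3 y' t.
  apply: T23; exists z; split=> //; rewrite -ball_normE /= sub0r normrN.
  by lra.
have {}T12 : translate T1 x (t.1, t.2 - (y - x')) <->
             translate T2 x' (t.1, t.2 - (y - x')).
  apply: T12; exists (z - (y - x')); split; first exact: supportB.
  rewrite -ball_normE /= sub0r normrN.
  by apply: le_lt_trans (ler_normB _ _) _; lra.
move: T12 T23; rewrite !translateP /=.
rewrite (_ : t.2 - (y - x') - x' = t.2 - y); last by lra.
rewrite (_ : t.2 - (y - x') - x = t.2 - (x + (y - x'))); last by lra.
by move=> -> ->.
Qed.

Definition tileset_entourage : set_system (tileset len * tileset len) :=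
  [set A | exists2 e, 0 < e & [set TT' | close e TT'.1 TT'.2] `<=` A].

Lemma tileset_entourage_filter : Filter tileset_entourage.
Proof.
split; first by exists 1.
- move=> A B [e e0 eA] [f f0 fB]; exists (Num.min e f).
    by rewrite lt_min e0 f0.
  have m0 : 0 < Num.min e f by rewrite lt_min e0 f0.
  move=> TT' cl; split; [apply: eA|apply: fB]; apply: close_le cl => //.
    by rewrite ge_min lexx.
  by rewrite ge_min lexx orbT.
- by move=> A B AB [e e0 eA]; exists e => // TT' /eA /AB.
Qed.

Local Open Scope relation_scope.

Lemma tileset_entourage_diagonal A : tileset_entourage A -> diagonal `<=` A.
Proof.
by move=> [e e0 eA] [T T'] /diagonalP <-; apply: eA; exact: close_refl.
Qed.

Lemma tileset_entourage_inv A : tileset_entourage A -> tileset_entourage A^-1.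
Proof.
by move=> [e e0 eA]; exists e => // -[T T'] cl; apply: eA; exact: close_sym.
Qed.

Lemma tileset_entourage_split A : tileset_entourage A ->
  exists2 B, tileset_entourage B & B \; B `<=` A.
Proof.
move=> [e e0 eA]; set d := Num.min (e / 3) (1 / 2).
exists [set TT' | close d TT'.1 TT'.2].
  by exists d => //; rewrite lt_min; apply/andP; split; lra.
by move=> [T1 T3] [T2 /= T12 T23]; apply: eA; exact: close_split T12 T23.
Qed.

End Tilings.

(* The uniform structure of the tiling metric. *)
HB.instance Definition _ (R : realType) (I : finType) (len : I -> R) :=
  isUniform.Build (tileset len) (@tileset_entourage_filter R I len)
    (@tileset_entourage_diagonal R I len) (@tileset_entourage_inv R I len)
    (@tileset_entourage_split R I len).

(* The tilings by translates of the proto-tiles form a complete space, so the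
   completion of the translation orbit of a tiling is its closure. *)
Definition hull (R : realType) (I : finType) (len : I -> R) (T : tileset len) :
    set (tileset len) :=
  closure (range (translate T)).

(* Isomorphism of tiling spaces: a homeomorphism commuting with the action of R
   by translation. *)
Definition conjugate_spaces (R : realType) (I J : finType) (len : I -> R)
    (len' : J -> R) (A : set (tileset len)) (B : set (tileset len')) : Prop :=
  exists2 h : tileset len -> tileset len', homeo_on A B h &
    forall T x, A T -> h (translate T x) = translate (h T) x.

(** * Canonical projection tilings *)

Section Canonical.
Context {R : realType} (alpha : R).

(* Coordinates of the orthogonal projections with respect to the unit vectors
   (1, alpha) / sqrt (1 + alpha^2) of the line of slope alpha and
   (- alpha, 1) / sqrt (1 + alpha^2) of its orthogonal complement. *)
Definition pr1 (y : R * R) : R :=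
  (y.1 + alpha * y.2) / Num.sqrt (1 + alpha ^+ 2).
Definition pr2 (y : R * R) : R :=
  (y.2 - alpha * y.1) / Num.sqrt (1 + alpha ^+ 2).

Definition window : set R := pr2 @` (`[0, 1] `*` `[0, 1]).

(* Of the points (1, 0) and (0, 1), the first one is kept. *)
Definition vertices : set R :=
  [set pr1 (y.1%:~R, y.2%:~R) | y in [set y : int * int |
     window (pr2 (y.1%:~R, y.2%:~R)) /\ y <> (0, 1)]].

Definition canonical_len (b : bool) : R :=
  (if b then alpha else 1) / Num.sqrt (1 + alpha ^+ 2).

Definition canonical_tiling : tileset canonical_len :=
  [set t | [/\ vertices t.2, vertices (t.2 + canonical_len t.1) &
     forall v, vertices v -> ~ (t.2 < v < t.2 + canonical_len t.1)]].

End Canonical.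

(** * Sturmian spaces *)

Definition biseq : Type := prod_topology (fun _ : int => bool).

HB.instance Definition _ := Topological.on biseq.

Definition shift (s : biseq) (k : int) : biseq := fun i => s (i + k).

(* The difference of the ceilings is 0 or 1 when 0 < alpha < 1. *)
Definition sturmian (R : realType) (alpha rho : R) : biseq := fun n =>
  Num.ceil (n%:~R * alpha + rho) - Num.ceil ((n - 1)%:~R * alpha + rho) == 1.

Definition sturmian_space (R : realType) (alpha : R) : set biseq :=
  closure [set sturmian alpha rho | rho in `[0, 1[ ].

Definition orbit (s : biseq) : set biseq := range (shift s).

Definition orbit_equivalence (X Y : set biseq) (h : biseq -> biseq) : Prop :=
  homeo_on X Y h /\ forall s, X s -> h @` orbit s = orbit (h s).

Definition is_cocycle (X : set biseq) (h : biseq -> biseq) (n : biseq -> int) :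
    Prop :=
  forall s, X s -> h (shift s 1) = shift (h s) (n s).

(* Continuity on X at s, int being discrete. *)
Definition cocycle_continuous_at (X : set biseq) (n : biseq -> int)
    (s : biseq) : Prop :=
  \forall s' \near within X (nbhs s), n s' = n s.

Definition strong_orbit_equivalent (X Y : set biseq) : Prop :=
  exists h : biseq -> biseq, exists n : biseq -> int,
    [/\ orbit_equivalence X Y h, is_cocycle X h n &
        forall s s', X s -> X s' ->
          ~ cocycle_continuous_at X n s -> ~ cocycle_continuous_at X n s' ->
          s = s'].

(** * Substitutions *)

Record substitution (R : realType) (I : finType) (len : I -> R) := Substitution {
  factor : R;
  rule : I -> tileset len;
  len_gt0 : forall i, 0 < len i;
  factor_gt1 : 1 < factor;
  rule_patch : forall i, is_patch (rule i);
  rule_support : forall i,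
    \bigcup_(t in rule i) @support R I len t = `[0, factor * len i]%classic
}.

Section Substitutions.
Context {R : realType} {I : finType} {len : I -> R} (w : substitution len).

Definition inflate (P : tileset len) : tileset len :=
  \bigcup_(t in P) translate (rule w t.1) (factor w * t.2).

Definition iterate (n : nat) (i : I) : tileset len :=
  iter n inflate [set (i, 0)].

Definition primitive : Prop :=
  exists N : nat, forall i j, exists x : R, iterate N i (j, x).

Definition generated_by (T : tileset len) : Prop :=
  is_tiling T /\
  forall P : tileset len, is_patch P -> P `<=` T ->
    exists n i x, translate P x `<=` iterate n i.

End Substitutions.

(* For primitive w the hull of T does not depend on the tiling T generated by
   w. *)
Definition is_substitution_tiling_space (R : realType) (I : finType)
    (len : I -> R) (Omega : set (tileset len)) : Prop :=
  exists (J : finType) (len' : J -> R) (w : substitution len')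
         (T : tileset len'),
    [/\ primitive w, generated_by w T & conjugate_spaces Omega (hull T)].

(* Main.v *)
Require Import Defs.
From HB Require Import structures.
From mathcomp Require Import all_boot all_order all_algebra.
From mathcomp Require Import all_classical all_reals all_analysis.
From mathcomp Require Import lra ring zify.
(* MathComp-Analysis has its own [close] and [support]. *)
Require Import Defs.
Import Order.TTheory GRing.Theory Num.Theory numFieldNormedType.Exports.
Local Open Scope classical_set_scope.
Local Open Scope ring_scope.

Set Implicit Arguments.
Unset Strict Implicit.
Unset Printing Implicit Defensive.

(* One may take beta = alpha. Let [q (m, n) = n - alpha m] on Z^2, let [p'] be a
   multiple of its Galois conjugate and [p] the projection onto the line, scaled
   so that [p' = p + kappa q].

   For a basis (u, v) of Z^2 with [q u < 0 < q v], a cut of Z^2 with respect to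
   the order defined by [q] selects the lattice points of a strip, and each of
   them is followed on the staircase by its translate by u or by v. Projecting
   the staircase by any functional that is positive on u and v gives a tiling.
   Every element of the hull arises from a cut and a translation. Changing [p]
   into [p + kappa q], or the basis, moves every vertex by an amount that depends
   continuously on the tiling, so it does not change the hull up to conjugacy.

   The Farey algorithm started at the standard basis eventually makes [p']
   positive on u and v. From then on the integral form proportional to [q p'] is
   indefinite with fixed discriminant in the successive bases, with coefficients
   of opposite signs, so two of the bases give it the same coefficients. The
   automorphism of Z^2 mapping one to the other multiplies [q] by some eps < 1
   and [p'] by some lam > 1; hence the staircase tilings of the first basis,
   projected by [p'], are generated by a substitution with two tiles. *)

(** * Staircases in a lattice *)

(** A nonzero integer multiple is at least as large in absolute value. In this form integrality
    becomes available to linear arithmetic. *)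
Lemma int_mul_cases (R : realType) (m : int) (x y : R) : x < 0 -> 0 < y ->
  [\/ - x <= m%:~R * x /\ m%:~R * y <= - y, m = 0 |
      m%:~R * x <= x /\ y <= m%:~R * y].
Proof.
move=> x0 y0; have [m0|m0|->] := ltgtP m 0; last exact: Or32.
- have m1 : m%:~R <= -1 :> R by rewrite (_ : -1 = (-1)%:~R) // ler_int; lia.
  apply: Or31; split; first by rewrite -mulN1r ler_nM2r.
  by rewrite -mulN1r ler_pM2r.
- have m1 : 1 <= m%:~R :> R by rewrite (_ : 1 = 1%:~R) // ler_int; lia.
  apply: Or33; split; first by rewrite -[leRHS]mul1r ler_nM2r.
  by rewrite -[leLHS]mul1r ler_pM2r.
Qed.

Section Strip.
Context {R : realType} {G : zmodType}.

(** [len] is a parameter tied to [p] by equations, since it indexes the type of the tilings and has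
    to be [canonical_len] itself in the application. *)
Record strip (q p : {additive G -> R}) (u v : G) (len : bool -> R) : Prop :=
  Strip {
    strip_gen : forall z, exists m n : int, z = u *~ m + v *~ n;
    strip_inj : injective q;
    strip_qu : q u < 0;
    strip_qv : 0 < q v;
    strip_len0 : len false = p u;
    strip_len1 : len true = p v;
    strip_pu : 0 < p u;
    strip_pv : 0 < p v }.

(* At most one point, with [q z = - s], is left undecided. *)
Definition is_cut (q : G -> R) (C : set G) (s : R) : Prop :=
  forall z, (0 < q z + s -> C z) /\ (q z + s < 0 -> ~ C z).

(* [z] is followed by [z + v] on the staircase if [i] is true, by [z + u]
   otherwise. *)
Definition vertex (u v : G) (C : set G) (i : bool) (z : G) : Prop :=
  if i then ~ C z /\ C (z - u) else C z /\ ~ C (z - v).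

Definition strip_tiling (p : G -> R) (u v : G) (len : bool -> R) (C : set G)
    (x : R) : tileset len :=
  [set t | exists2 z, vertex u v C t.1 z & t.2 = p z + x].

Section Theory.
Context (q p : {additive G -> R}) (u v : G) (len : bool -> R).
Context (S : strip q p u v len).

Lemma strip_len_gt0 i : 0 < len i.
Proof.
by case: i; rewrite ?(strip_len1 S, strip_len0 S) ?(strip_pu S, strip_pv S).
Qed.

(* The components of [z] along [u] and [v], each read off by [q] and [p]. *)
Lemma strip_cases z : exists a b c d,
  [/\ q z = a + b, p z = c + d,
     [\/ - q u <= a /\ c <= - p u, a = 0 /\ c = 0 | a <= q u /\ p u <= c],
     [\/ b <= - q v /\ d <= - p v, b = 0 /\ d = 0 | q v <= b /\ p v <= d] &
     a = 0 -> b = 0 -> z = 0].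
Proof.
have [m [n ->]] := strip_gen S z.
exists (m%:~R * q u), (n%:~R * q v), (m%:~R * p u), (n%:~R * p v).
split.
- by rewrite raddfD !raddfMz -(mulrzl (q u)) -(mulrzl (q v)).
- by rewrite raddfD !raddfMz -(mulrzl (p u)) -(mulrzl (p v)).
- case: (int_mul_cases m (strip_qu S) (strip_pu S)) => [|->|]; rewrite ?mul0r.
  + exact: Or31.
  + exact: Or32.
  + exact: Or33.
- have v0 : - q v < 0 by rewrite oppr_lt0 (strip_qv S).
  case: (int_mul_cases n v0 (strip_pv S)) => [|->|]; rewrite ?mul0r ?mulrN ?opprK.
  + by rewrite lerNr => -[? ?]; apply: Or31.
  + by apply: Or32.
  + by rewrite lerN2 => -[? ?]; apply: Or33.
- have := strip_qu S; have := strip_qv S => v0 u0.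
  move=> /eqP; rewrite mulf_eq0 (lt_eqF u0) orbF intr_eq0 => /eqP ->.
  move=> /eqP; rewrite mulf_eq0 (gt_eqF v0) orbF intr_eq0 => /eqP ->.
  by rewrite !mulr0z addr0.
Qed.

Let pos : [/\ q u < 0, 0 < q v, 0 < p u & 0 < p v].
Proof. by case: S. Qed.

(** If the coefficients of [z] have equal signs, the absolute values of their contributions to [p z]
    add up; if opposite signs, those to [q z] do. This box holds the difference of two vertices
    labelled false with overlapping tiles; the next two boxes serve the other pairs of labels. *)
Lemma strip_small_u z : - q v < q z < q v -> - p u < p z < p u -> z = 0.
Proof.
have [? ? ? ?] := pos.
have [a [b [c [d [-> -> [[? ?]|[? ?]|[? ?]] [[? ?]|[? ?]|[? ?]] Z]]]]] :=
  strip_cases z => *;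
  by [apply: Z|exfalso; clear Z; lra].
Qed.

Lemma strip_small_v z : q u < q z < - q u -> - p v < p z < p v -> z = 0.
Proof.
have [? ? ? ?] := pos.
have [a [b [c [d [-> -> [[? ?]|[? ?]|[? ?]] [[? ?]|[? ?]|[? ?]] Z]]]]] :=
  strip_cases z => *;
  by [apply: Z|exfalso; clear Z; lra].
Qed.

Lemma strip_small_uv z : 0 < q z < q v - q u -> - p u < p z < p v -> False.
Proof.
have [? ? ? ?] := pos.
have [a [b [c [d [-> -> [[? ?]|[? ?]|[? ?]] [[? ?]|[? ?]|[? ?]] Z]]]]] :=
  strip_cases z; clear Z; lra.
Qed.

(** Here and in [strip_gap_v] one end of the range of [q] is included: the lattice point there,
    [- v] or [- u], is kept out by the strict bounds on [p]. *)
Lemma strip_gap_u z : - q v <= q z < 0 -> - p v < p z < p u -> False.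
Proof.
have [? ? ? ?] := pos.
have [a [b [c [d [-> -> [[? ?]|[? ?]|[? ?]] [[? ?]|[? ?]|[? ?]] Z]]]]] :=
  strip_cases z; clear Z; lra.
Qed.

Lemma strip_gap_v z : 0 < q z <= - q u -> - p u < p z < p v -> False.
Proof.
have [? ? ? ?] := pos.
have [a [b [c [d [-> -> [[? ?]|[? ?]|[? ?]] [[? ?]|[? ?]|[? ?]] Z]]]]] :=
  strip_cases z; clear Z; lra.
Qed.

End Theory.
End Strip.

Section Cut.
Context {R : realType} {G : zmodType}.
Context (q p : {additive G -> R}) (u v : G) (len : bool -> R).
Context (S : strip q p u v len) (C : set G) (s : R) (cutC : is_cut q C s).

Lemma cut_ge0 z : C z -> 0 <= q z + s.
Proof. by move=> Cz; rewrite leNgt; apply/negP => /(cutC z).2. Qed.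

Lemma cut_le0 z : ~ C z -> q z + s <= 0.
Proof. by move=> nCz; rewrite leNgt; apply/negP => /(cutC z).1. Qed.

(** Strict because the undecided level is attained at most once, by injectivity of [q]. *)
Lemma cut_lt z z' : C z -> ~ C z' -> q z' < q z.
Proof.
move=> Cz nCz'; rewrite lt_neqAle; apply/andP; split.
  by apply/eqP => /(strip_inj S) zz'; apply: nCz'; rewrite zz'.
by have := cut_ge0 Cz; have := cut_le0 nCz'; lra.
Qed.

Lemma cut_le z z' : q z <= q z' -> C z -> C z'.
Proof.
by move=> zz' Cz; apply: contrapT => /(cut_lt Cz); rewrite ltNge zz'.
Qed.

Lemma vertex_bounds i z : vertex u v C i z -> q u <= q z + s <= q v.
Proof.
have qu := strip_qu S; have qv := strip_qv S.
by case: i => -[]; [move=> /cut_le0 ? /cut_ge0|move=> /cut_ge0 ? /cut_le0];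
  rewrite raddfB; lra.
Qed.

Lemma vertex_overlap i j z z' : vertex u v C i z -> vertex u v C j z' ->
  p z < p z' + len j -> p z' < p z + len i -> z = z'.
Proof.
have qu := strip_qu S; have qv := strip_qv S.
have uv : forall z z', vertex u v C false z -> vertex u v C true z' ->
    p z < p z' + len true -> p z' < p z + len false -> z = z'.
  move=> {}z {}z' [Cz Czv] [Cz' Cz'u] h1 h2; exfalso.
  apply: (strip_small_uv S (z := z - z')).
    have := cut_lt Cz Cz'; have := cut_lt Cz'u Czv; rewrite !raddfB; lra.
  by move: h1 h2; rewrite (strip_len0 S) (strip_len1 S) raddfB; lra.
case: i; case: j => Vz Vz' h1 h2.
- apply/eqP; rewrite -subr_eq0; apply/eqP/(strip_small_v S).
    case: Vz Vz' => a b [c d].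
    have := cut_lt b c; have := cut_lt d a; rewrite !raddfB; lra.
  by move: h1 h2; rewrite (strip_len1 S) raddfB; lra.
- by apply/esym; apply: uv.
- exact: uv.
- apply/eqP; rewrite -subr_eq0; apply/eqP/(strip_small_u S).
    case: Vz Vz' => a b [c d].
    have := cut_lt a d; have := cut_lt c b; rewrite !raddfB; lra.
  by move: h1 h2; rewrite (strip_len0 S) raddfB; lra.
Qed.

Lemma vertex_label i j z : vertex u v C i z -> vertex u v C j z -> i = j.
Proof. by case: i; case: j => -[? ?] []. Qed.

Lemma vertex_next i z : vertex u v C i z ->
  exists j, vertex u v C j (z + if i then v else u).
Proof.
have qu := strip_qu S; have qv := strip_qv S.
case: i => -[h1 h2].
- have [Cz|nCz] := pselect (C (z + v)); first by exists false; rewrite /= addrK.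
  exists true; split=> //; apply: cut_le h2; rewrite !(raddfB, raddfD); lra.
- have [Cz|nCz] := pselect (C (z + u)); last by exists true; rewrite /= addrK.
  exists false; split=> //= Cuv; apply: h2; apply: cut_le Cuv.
  by rewrite !(raddfB, raddfD); lra.
Qed.

Lemma vertex_prev i z : vertex u v C i z ->
  exists j, vertex u v C j (z - if j then v else u).
Proof.
have qu := strip_qu S; have qv := strip_qv S => Vz.
have [Cuv|nCuv] := pselect (C (z - v - u)).
  exists true; split=> //; case: i Vz => -[h1 h2] // Czv; apply: h1.
  by apply: cut_le Czv; rewrite !raddfB; lra.
exists false; split; last by rewrite addrAC.
case: i Vz => -[h1 h2] //; apply: cut_le h1.
by rewrite !raddfB; lra.
Qed.

Lemma strip_p_step i : p (if i then v else u) = len i.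
Proof. by case: i; rewrite ?(strip_len0 S) ?(strip_len1 S). Qed.

Lemma vertex_exists : exists i z, vertex u v C i z.
Proof.
have qv := strip_qv S.
have [n Cn] : exists n, C (v *~ n).
  exists (Num.ceil (- s / q v) + 1); apply: (cutC _).1.
  rewrite raddfMz /= -(mulrzl (q v)) -ltrBlDr sub0r -ltr_pdivrMr //.
  by rewrite intrD; have := Num.Theory.ceil_ge (- s / q v); lra.
have [m Cm] : exists m : nat, ~ C (v *~ (n - m%:Z)).
  have [k [kn nCk]] : exists k : int, k < n /\ ~ C (v *~ k).
    exists (Num.min (n - 1) (Num.floor (- s / q v) - 1)); split.
      by rewrite gt_min; apply/orP; left; lia.
    apply: (cutC _).2; rewrite raddfMz /= -(mulrzl (q v)) -ltrBrDr sub0r.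
    rewrite -ltr_pdivlMr // (@le_lt_trans _ _ (Num.floor (- s / q v) - 1)%:~R) //.
      by rewrite ler_int ge_min lexx orbT.
    by rewrite intrD; have := Num.Theory.floor_le (- s / q v); lra.
  by exists `|n - k|%N; rewrite (_ : n - _ = k) //; lia.
(* Going down from a multiple of [v] inside the cut to one outside, the last one still inside is a
   vertex labelled false. *)
elim: m n Cn Cm => [n Cn|m IH n Cn Cm]; first by rewrite subr0.
have [C1|nC1] := pselect (C (v *~ (n - 1))).
  by apply: (IH _ C1); rewrite (_ : n - 1 - m%:Z = n - m.+1%:Z) //; lia.
by exists false, (v *~ n); split=> //=; rewrite -[v in _ - v]mulr1z -mulrzBr.
Qed.

(** Walk back from some vertex until it lies left of [y], then forward to the tile reaching [y].
    Each step is at least the shorter length [l], so both walks end. *)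
Lemma strip_cover x y : exists2 t, strip_tiling p u v len C x t &
  t.2 < y <= t.2 + len t.1.
Proof.
pose l := Num.min (len true) (len false).
have l0 : 0 < l by rewrite lt_min !(strip_len_gt0 S).
have ll i : l <= len i by case: i; rewrite ge_min lexx ?orbT.
have natP r : exists n : nat, r < n%:R * l.
  exists (Num.bound (`|r| / l)); rewrite -ltr_pdivrMr //.
  apply: le_lt_trans (archi_boundP _); last by rewrite divr_ge0 // ltW.
  by rewrite ler_pM2r ?invr_gt0 // ler_norm.
have [i [z [Vz zy]]] : exists i z, vertex u v C i z /\ p z + x < y.
  have [i [z Vz]] := vertex_exists; have [n] := natP (p z + x - y).
  elim: n i z Vz => [|n IH] i z Vz zn.
    by exists i, z; split=> //; move: zn; rewrite mul0r; lra.
  have [j Vj] := vertex_prev Vz; apply: (IH _ _ Vj).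
  rewrite raddfB strip_p_step; move: zn; rewrite -natr1 mulrDl mul1r.
  by have := ll j; lra.
have [n] := natP (y - (p z + x)); elim: n i z Vz zy => [|n IH] i z Vz zy zn.
  by move: zn; rewrite mul0r; lra.
have [yl|yl] := leP y (p z + x + len i).
  by exists (i, p z + x); [exists z|rewrite /= zy yl].
have [j Vj] := vertex_next Vz; apply: (IH _ _ Vj).
  by rewrite raddfD strip_p_step; lra.
rewrite (raddfD p) strip_p_step; move: zn; rewrite -natr1 mulrDl mul1r.
by have := ll i; lra.
Qed.

Lemma strip_tiling_overlap x t t' :
  strip_tiling p u v len C x t -> strip_tiling p u v len C x t' ->
  t.2 < t'.2 + len t'.1 -> t'.2 < t.2 + len t.1 -> t = t'.
Proof.
case: t t' => [i a] [j b] [z /= Vz ->] [z' /= Vz' ->] h1 h2.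
have zz' : z = z' by apply: (vertex_overlap Vz Vz'); lra.
by move: Vz Vz'; rewrite zz' => Vz /(vertex_label Vz) ->.
Qed.

Lemma strip_nonoverlapping x : nonoverlapping (strip_tiling p u v len C x).
Proof.
move=> t t' Tt Tt' tt'; rewrite -subset0 => y [] /=; rewrite !in_itv /=.
by move=> ? ?; apply/tt'/(strip_tiling_overlap Tt Tt'); lra.
Qed.

Lemma strip_is_tiling x : is_tiling (strip_tiling p u v len C x).
Proof.
split; first exact: strip_nonoverlapping.
rewrite -subTset => y _; have [t Tt ty] := strip_cover x y.
by exists t => //; rewrite /support /= in_itv /=; lra.
Qed.

End Cut.

(** * Conjugacy of the hulls *)

Section Close.
Context {R : realType} {I : finType} {len : I -> R}.
Implicit Types (T : tileset len).

(** Merges the two translations of [close] into one displacement, on a smaller window. [shift_close]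
    goes back by moving each tiling by half of it. *)
Lemma close_shift e T T' : (forall i, 0 < len i) -> close e T T' ->
  exists2 d, `|d| < e & forall t, `|t.2| + e < e^-1 ->
    (T t <-> T' (t.1, t.2 + d)).
Proof.
move=> len0 [x [x' [xe x'e TT']]]; exists (x - x').
  by apply: le_lt_trans (ler_normB _ _) _; lra.
move=> t te; have := TT' (t.1, t.2 + x).
rewrite !translateP /= addrK addrA -surjective_pairing; apply.
exists (t.2 + x); split; first by rewrite /support /= in_itv /= lexx lerDl ltW.
rewrite -ball_normE /= sub0r normrN; apply: le_lt_trans (ler_normD _ _) _.
by have := normr_ge0 x; lra.
Qed.

Lemma shift_close e d T T' : 0 < e -> `|d| < e ->
  (forall t, `|t.2| < e^-1 + len t.1 + e -> (T t <-> T' (t.1, t.2 + d))) ->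
  close e T T'.
Proof.
move=> e0 de TT'; exists (d / 2), (- (d / 2)).
split; [by rewrite normrM (gtr0_norm (x := 2^-1)) //; lra| |].
  by rewrite normrN normrM (gtr0_norm (x := 2^-1)) //; lra.
move=> t [z [tz]]; rewrite -ball_normE /= sub0r normrN => ze.
rewrite !translateP TT' /=; first by rewrite (_ : _ + d = t.2 - - (d / 2)) //; lra.
move: tz ze de; rewrite /support /= in_itv /= !ltr_norml.
by move=> /andP[? ?] /andP[? ?] /andP[? ?]; apply/andP; split; lra.
Qed.

(** Copies of a tile of [T] occur in [T'] at arbitrarily small displacements. Two of them overlap,
    hence coincide, so the displacement is zero. *)
Lemma close_all_eq T T' : (forall i, 0 < len i) ->
  (forall t t', T' t -> T' t' -> t.2 < t'.2 + len t'.1 -> t'.2 < t.2 + len t.1 ->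
     t = t') ->
  (forall e, 0 < e -> close e T T') -> T = T'.
Proof.
move=> len0 sep TT'.
have near T1 T2 t e : (forall e, 0 < e -> close e T1 T2) -> 0 < e ->
    exists2 d, `|d| < e & T1 t <-> T2 (t.1, t.2 + d).
  move=> T12 e0; pose f := Num.min (Num.min e 1) (`|t.2| + 2)^-1.
  have t0 : 0 < `|t.2| + 2 by have := normr_ge0 t.2; lra.
  have f0 : 0 < f by rewrite !lt_min e0 ltr01 invr_gt0 t0.
  have [fe f1 ft] : [/\ f <= e, f <= 1 & f <= (`|t.2| + 2)^-1].
    by rewrite /f !ge_min !lexx !orbT.
  have [d df h] := close_shift len0 (T12 _ f0).
  exists d; first exact: lt_le_trans fe.
  apply: h; have : `|t.2| + 2 <= f^-1.
    by rewrite -[leLHS]invrK lef_pV2 // posrE invr_gt0.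
  lra.
have sub t : T t -> T' t.
  move=> Tt; have [d dl [+ _]] := near _ _ t _ TT' (len0 t.1) => /(_ Tt) T'd.
  suff d0 : d = 0 by move: T'd; rewrite d0 addr0; case: t {Tt dl}.
  apply/eqP; rewrite -normr_le0 leNgt; apply/negP => d0.
  have f0 : 0 < Num.min `|d| (len t.1 - `|d|) by rewrite lt_min d0 subr_gt0.
  have [d' dl' [+ _]] := near _ _ t _ TT' f0 => /(_ Tt) T'd'.
  move: dl'; rewrite lt_min => /andP[dd' dl'].
  have : t.2 + d = t.2 + d'.
    suff [] : (t.1, t.2 + d) = (t.1, t.2 + d') by [].
    apply: sep => //=.
      by have := ler_norm d; have := lerNnormlW (lexx `|d'|); lra.
    by have := ler_norm d'; have := lerNnormlW (lexx `|d|); lra.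
  by move=> /addrI dE; move: dd'; rewrite dE ltxx.
apply/seteqP; split=> t; first exact: sub.
move=> T't; have [d dl [/(_ T't) Td _]] :=
  near _ _ t _ (fun e e0 => close_sym (TT' e e0)) (len0 t.1).
have -> // : t = (t.1, t.2 + d).
apply: sep => //=; first exact: sub.
  by have := lerNnormlW (lexx `|d|); lra.
by have := ler_norm d; lra.
Qed.
End Close.

Section Near.
Context {R : realType} {G : zmodType}.

(** Closeness on the level of parameters. It refers to no basis, which is what allows the basis to
    be changed. *)
Definition near_cuts (p : G -> R) (r : R) (C : set G) (s x : R)
    (C' : set G) (s' x' : R) : Prop :=
  [/\ `|s - s'| < r, `|x - x'| < r &
      forall z, `|p z + x| < r^-1 -> (C z <-> C' z)].

(** At a vertex [q z + s] is bounded, so the positions for [p] and [p'] differ by the bounded amount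
    [kappa * (q z + s)]. Being a vertex depends on the cut at [z], [z - u] and [z - v] only. *)
Lemma near_close (q p : {additive G -> R}) (u v : G) (len : bool -> R)
    (p' : {additive G -> R}) (kappa e : R) :
  strip q p u v len -> (forall z, p z = p' z + kappa * q z) -> 0 < e ->
  exists2 r, 0 < r & forall C s x C' s' x', is_cut q C s -> is_cut q C' s' ->
    near_cuts p' r C s x C' s' x' ->
    close e (strip_tiling p u v len C (x + kappa * s))
      (strip_tiling p u v len C' (x' + kappa * s')).
Proof.
move=> S pE e0.
pose K := q v - q u; pose M := `|p' u| + `|p' v|; pose L := len false + len true.
(* [W] covers the window of [shift_close], the displacement, the change of projection, the steps by
   [u] and [v] (in [M]) and [x - x']; the quotient by [e] keeps the displacement below [e]. *)
pose W := e^-1 + L + e + e + `|kappa| * K + M + 1 + (1 + `|kappa|) / e + 1.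
have K0 : 0 < K by rewrite /K; have := strip_qu S; have := strip_qv S; lra.
have L0 : 0 < L by apply: addr_gt0; apply: (strip_len_gt0 S).
have ei0 : 0 < e^-1 by rewrite invr_gt0.
have kK0 : 0 <= `|kappa| * K by rewrite mulr_ge0 // ltW.
have ke0 : 0 <= (1 + `|kappa|) / e by rewrite divr_ge0 ?addr_ge0 // ltW.
have [pu0 pv0] := (normr_ge0 (p' u), normr_ge0 (p' v)).
have W1 : 1 <= W by rewrite /W /M; lra.
have W0 : 0 < W by lra.
exists W^-1; first by rewrite invr_gt0.
move=> C s x C' s' x' cutC cutC' [ss xx]; rewrite invrK => CC'.
have r1 : W^-1 <= 1 by rewrite invf_le1.
have pvz z : p' (z - v) = p' z - p' v by rewrite raddfB.
have puz z : p' (z - u) = p' z - p' u by rewrite raddfB.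
have nu := ler_norm (p' u); have nu' := lerNnormlW (lexx `|p' u|).
have nv := ler_norm (p' v); have nv' := lerNnormlW (lexx `|p' v|).
have VV' i z : `|p' z + x| < W - M -> vertex u v C i z <-> vertex u v C' i z.
  rewrite /M => zW.
  have CC'z : C z <-> C' z by apply: CC'; lra.
  have CC'v : C (z - v) <-> C' (z - v).
    by apply: CC'; rewrite pvz; move: zW; rewrite !ltr_norml; lra.
  have CC'u : C (z - u) <-> C' (z - u).
    by apply: CC'; rewrite puz; move: zW; rewrite !ltr_norml; lra.
  by case: i; rewrite /= CC'z ?CC'v ?CC'u.
have bound C1 s1 x1 i z : is_cut q C1 s1 -> vertex u v C1 i z ->
    `|p' z + x1| <= `|p z + (x1 + kappa * s1)| + `|kappa| * K.
  move=> cutC1 Vz; have sK : `|q z + s1| <= K.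
    have := vertex_bounds S cutC1 Vz; have := strip_qu S; have := strip_qv S.
    by rewrite ler_norml /K; lra.
  rewrite (_ : p' z + x1 = p z + (x1 + kappa * s1) - kappa * (q z + s1)).
    by apply: le_trans (ler_normB _ _) _; rewrite lerD2l normrM ler_wpM2l.
  by rewrite pE; ring.
pose d := (x' + kappa * s') - (x + kappa * s).
have de : `|d| < e.
  rewrite (_ : d = - ((x - x') + kappa * (s - s'))); last by rewrite /d; ring.
  rewrite normrN; apply: le_lt_trans (ler_normD _ _) _; rewrite normrM.
  apply: (@le_lt_trans _ _ ((1 + `|kappa|) * W^-1)).
    by rewrite mulrDl mul1r lerD // ?(ltW xx) // ler_wpM2l // ltW.
  by rewrite ltr_pdivrMr // -ltr_pdivrMl // mulrC /W /M; lra.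
apply: (shift_close e0 de) => t te.
have tL : len t.1 <= L.
  by rewrite /L; case: t.1; have := strip_len_gt0 S true;
    have := strip_len_gt0 S false; lra.
split=> -[z /= Vz tE]; exists z => //=.
- apply/VV' => //; apply: le_lt_trans (bound _ _ _ _ _ cutC Vz) _.
  by rewrite -tE /W; lra.
- by rewrite tE /d; ring.
- apply/VV' => //; have /= := bound _ _ x' _ _ cutC' Vz; rewrite -tE.
  have := ler_normD t.2 d; move: xx.
  have -> : p' z + x = (p' z + x') + (x - x') by ring.
  have := ler_normD (p' z + x') (x - x').
  rewrite /W; lra.
- by move: tE; rewrite /d; lra.
Qed.

End Near.

(** * Recovering a cut from its tiling *)

Section Dense.
Context {R : realType} {G : zmodType}.
Context (q p : {additive G -> R}) (u v : G) (len : bool -> R).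
Context (S : strip q p u v len).
Context (q_dense : forall r, 0 < r -> exists z, 0 < q z < r).

(** A vertex near the origin has bounded [q z + s]; boundedly many copies of a vector [d] with small
    positive [q d] bring this value close to zero. *)
Lemma strip_dense r : 0 < r -> exists2 N, 0 < N & forall C s x, is_cut q C s ->
  (exists2 z, `|p z + x| <= N & 0 < q z + s < r) /\
  (exists2 z, `|p z + x| <= N & - r < q z + s < 0).
Proof.
move=> r0; have [d /andP[d0 dr]] := q_dense (divr_gt0 r0 (ltr0Sn R 1)).
pose K := q v - q u; pose L := len false + len true.
have K0 : 0 < K by rewrite /K; have := strip_qu S; have := strip_qv S; lra.
have L0 : 0 < L by apply: addr_gt0; apply: (strip_len_gt0 S).
have B0 : 0 <= (K / q d + 2) * `|p d|.
  by rewrite mulr_ge0 // addr_ge0 // divr_ge0 // ltW.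
exists (L + (K / q d + 2) * `|p d|); first by lra.
move=> C s x cutC; have [t [z Vz tE] t0] := strip_cover S cutC x 0.
have tL : `|p z + x| <= L.
  rewrite -tE ler_norml /L; move: t0; have := strip_len_gt0 S true.
  by have := strip_len_gt0 S false; case: t.1; lra.
pose w := q z + s; have wK : `|w| <= K.
  have := vertex_bounds S cutC Vz; have := strip_qu S; have := strip_qv S.
  by rewrite ler_norml /K /w; lra.
pose k := Num.floor (w / q d).
have [k1 k2] : k%:~R <= w / q d /\ w / q d < k%:~R + 1.
  split; first exact: Num.Theory.floor_le.
  by have := Num.Theory.floorD1_gt (w / q d); rewrite intrD.
have wd : `|w / q d| <= K / q d.
  by rewrite normrM normfV (gtr0_norm d0) ler_pM2r ?invr_gt0.
have kK : `|k%:~R| + 1 <= K / q d + 2 :> R.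
  have : `|k%:~R| <= `|w / q d| + 1 :> R; last by lra.
  by rewrite ler_norml; have := ler_norm (w / q d);
    have := lerNnormlW (lexx `|w / q d|); lra.
move: k1 k2; rewrite ler_pdivlMr // ltr_pdivrMr // => k1 k2.
(* [j = 0] would give a value of [q] plus [s] that may vanish; [1] and [-1] give a strictly positive
   and a strictly negative one. *)
have zk (j : int) : `|j%:~R| <= 1 :> R ->
    `|p (z + d *~ (j - k)) + x| <= L + (K / q d + 2) * `|p d|.
  move=> j1; rewrite raddfD raddfMz addrAC; apply: le_trans (ler_normD _ _) _.
  rewrite lerD // -[p d *~ _]mulrzl normrM ler_wpM2r // intrD intrN.
  by apply: le_trans (ler_normB _ _) _; lra.
have qk (j : int) : q (z + d *~ (j - k)) + s = w + (j%:~R - k%:~R) * q d.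
  by rewrite raddfD raddfMz -[q d *~ _]mulrzl intrD intrN /w; ring.
split.
- by exists (z + d *~ (1 - k)); [apply: zk; rewrite normr1|rewrite qk; lra].
- exists (z + d *~ (-1 - k)); first by apply: zk; rewrite normrN normr1.
  by rewrite qk intrN; lra.
Qed.

Definition translate_set (C : set G) (y : G) : set G := [set z | C (z + y)].

Lemma is_cut_translate C s y :
  is_cut q C s -> is_cut q (translate_set C y) (s + q y).
Proof.
move=> cutC z; have := cutC (z + y); rewrite raddfD.
by rewrite (_ : q z + (s + q y) = q z + q y + s) //; ring.
Qed.

Lemma vertex_translate C i y z :
  vertex u v (translate_set C y) i z <-> vertex u v C i (z + y).
Proof. by case: i; rewrite /vertex /translate_set /= !(addrAC z y). Qed.

(** A lattice shift of the origin changes the parameters but not the tiling, so a tiling determines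
    them at best up to the lattice. *)
Lemma strip_tiling_translate C y x :
  strip_tiling p u v len (translate_set C y) (x + p y) = strip_tiling p u v len C x.
Proof.
apply/seteqP; split=> t [z /= Vz tE].
  by exists (z + y); [exact/vertex_translate|rewrite tE raddfD /=; ring].
exists (z - y); first by apply/vertex_translate; rewrite subrK.
by rewrite tE raddfB /=; ring.
Qed.

Lemma translate_strip_tiling C x y :
  translate (strip_tiling p u v len C x) y = strip_tiling p u v len C (x + y).
Proof.
apply/seteqP; split=> t.
  by move=> /translateP[z /= Vz tE]; exists z => //; lra.
by move=> [z /= Vz tE]; apply/translateP; exists z => //=; lra.
Qed.

Context (p_inj : injective p).

(** Converse of [near_close], up to a lattice vector. Once one vertex of each tiling is matched,
    injectivity of [p] matches all vertices near the origin as lattice points, and the vertices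
    close to the cut determine it. *)
Lemma close_near r : 0 < r -> exists2 d, 0 < d &
  forall C s x C' s' x', is_cut q C s -> is_cut q C' s' ->
  close d (strip_tiling p u v len C x) (strip_tiling p u v len C' x') ->
  exists y, near_cuts p r C s x (translate_set C' y) (s' + q y) (x' + p y).
Proof.
(* For such [r], every lattice point within [r] of the cut is a vertex. *)
wlog [rv ru] : r / r <= q v /\ r <= - q u.
  have u0 : 0 < - q u by have := strip_qu S; lra.
  move=> H r0; have r'0 : 0 < Num.min r (Num.min (q v) (- q u)).
    by rewrite !lt_min r0 (strip_qv S).
  have [|d d0 Hd] := H _ _ r'0; first by rewrite !ge_min !lexx !orbT.
  have rr : Num.min r (Num.min (q v) (- q u)) <= r by rewrite ge_min lexx.
  exists d => // C s x C' s' x' cutC cutC' /(Hd _ _ _ _ _ _ cutC cutC')[y [? ? CC']].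
  exists y; split; [lra|lra|move=> z zr; apply: CC'; apply: lt_le_trans zr _].
  by rewrite lef_pV2.
move=> r0; have [N N0 HN] := strip_dense r0.
pose L := len false + len true; pose W := N + r^-1 + r^-1 + L + 4.
have L0 : 0 < L by apply: addr_gt0; apply: (strip_len_gt0 S).
have ri0 : 0 < r^-1 by rewrite invr_gt0.
have W1 : 1 <= W by rewrite /W; lra.
have W0 : 0 < W by lra.
exists W^-1; first by rewrite invr_gt0.
have d1 : W^-1 <= 1 by rewrite invf_le1.
have dr : W^-1 < r by rewrite invf_plt // ?posrE // /W; lra.
move=> C s x C' s' x' cutC cutC'.
move=> /(close_shift (strip_len_gt0 S))[d dW]; rewrite invrK => TT'.
have [t [z0 /= Vz0 tE] t0] := strip_cover S cutC x 0.
have tL : `|p z0 + x| <= L.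
  rewrite -tE ler_norml /L; move: t0; have := strip_len_gt0 S true.
  by have := strip_len_gt0 S false; case: t.1; lra.
have [z1 /= Vz1 tE1] : strip_tiling p u v len C' x' (t.1, t.2 + d).
  by apply/TT'; [rewrite tE /W; lra|exists z0].
exists (z1 - z0); have xE : x' + p (z1 - z0) = x + d by rewrite raddfB /=; lra.
have := is_cut_translate (z1 - z0) cutC'; rewrite xE.
set C1 := translate_set _ _; set s1 := s' + _ => cutC1.
have VV' i z : `|p z + x| < W - 1 -> vertex u v C i z <-> vertex u v C1 i z.
  move=> zW; have zT : strip_tiling p u v len C x (i, p z + x) <->
      strip_tiling p u v len C1 (x + d) (i, p z + x + d).
    by rewrite -xE strip_tiling_translate; apply: (TT' (i, _)) => /=; lra.
  split=> Vz.
  - have /zT[z' /= Vz'] : strip_tiling p u v len C x (i, p z + x) by exists z.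
    by rewrite -addrA => /addIr/p_inj ->.
  - have /zT[z' /= Vz'] : strip_tiling p u v len C1 (x + d) (i, p z + x + d).
      by exists z => //=; rewrite addrA.
    by move=> /addIr/p_inj ->.
have V0 D c z : is_cut q D c -> D z -> q z + c < r -> vertex u v D false z.
  by move=> cutD Dz zr; split=> //; apply: (cutD _).2; rewrite raddfB; lra.
have ss1 : `|s - s1| < r.
  (* Points just above and just below the cut [C] keep their labels for [C1], which confines
     [s1]. *)
  have [[z zN zr] [z' z'N z'r]] := HN C s x cutC.
  have Cz : C z by apply: (cutC z).1; lra.
  have [C1z _] : vertex u v C1 false z.
    by apply/VV'; [rewrite /W; lra|apply: (V0 _ s) => //; lra].
  have := cut_ge0 cutC1 C1z.
  have nC1z' : ~ C1 z'.
    suff [] : vertex u v C1 true z' by [].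
    apply/VV'; first by rewrite /W; lra.
    by split; [apply: (cutC z').2; lra|apply: (cutC _).1; rewrite raddfB; lra].
  have := cut_le0 cutC1 nC1z'.
  by rewrite ltr_norml; lra.
split=> //.
  by rewrite (_ : x - _ = - d); [rewrite normrN; lra|ring].
(* A point on which the cuts disagree is within [r] of the one containing it, hence a vertex
   labelled false there, and so for the other cut as well. *)
move=> z zr; split=> [Cz|C1z].
- apply: contrapT => nC1z; have [] : vertex u v C1 false z => [|//].
  apply/VV'; first by rewrite /W; lra.
  apply: (V0 _ s) => //; have := cut_le0 cutC1 nC1z.
  by move: ss1; rewrite ltr_norml; lra.
- apply: contrapT => nCz; have [] : vertex u v C false z => [|//].
  apply/VV'; first by rewrite /W; lra.
  apply: (V0 _ s1) => //; have := cut_le0 cutC nCz.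
  by move: ss1; rewrite ltr_norml; lra.
Qed.

End Dense.

Section Topology.
Context {R : realType} {I : finType} {len : I -> R}.
Implicit Types T : tileset len.

Lemma nbhs_close e T : 0 < e -> nbhs T [set T' | close e T T'].
Proof.
move=> e0; apply/nbhsP; exists [set TT' | close e TT'.1 TT'.2]; first by exists e.
by move=> T' /xsectionP.
Qed.

Lemma nbhs_close_sub T (B : set (tileset len)) : nbhs T B ->
  exists2 e, 0 < e & forall T', close e T T' -> B T'.
Proof.
move=> /nbhsP[A [e e0 eA] AB]; exists e => // T' TT'.
by apply/AB/xsectionP; apply: eA.
Qed.

Lemma hullP T0 T : hull T0 T <->
  forall e, 0 < e -> exists y, close e T (translate T0 y).
Proof.
split=> [hT e e0|hT B /nbhs_close_sub[e e0 eB]].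
  by have [_ [[y _ <-] ?]] := hT _ (nbhs_close T e0); exists y.
by have [y /eB ?] := hT e e0; exists (translate T0 y); split=> //; exists y.
Qed.

End Topology.

(** * The hull of a staircase tiling *)

Section Hull.
Context {R : realType} {G : zmodType}.
Context (q p : {additive G -> R}) (u v : G) (len : bool -> R).
Context (S : strip q p u v len).

Lemma int_bounded (B : R) : exists l : seq int,
  forall m : int, `|m%:~R| <= B -> m \in l.
Proof.
pose b := Num.bound B.
exists ([seq k%:Z | k <- iota 0 b] ++ [seq - k%:Z | k <- iota 0 b]) => m mB.
have mb : (`|m| < b)%N.
  rewrite -(ltr_nat R) natr_absz (le_lt_trans _ (archi_boundP _)) //.
    by rewrite intr_norm.
  by apply: le_trans mB.
rewrite mem_cat; case: (lerP 0 m) => m0; apply/orP; [left|right];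
  apply/mapP; exists `|m|%N; rewrite ?mem_iota //; lia.
Qed.

(** Cramer's rule, with a determinant [D] that is positive by the signs of [q] and [p], bounds the
    coefficients of [z]. *)
Lemma strip_finite (P Q : R) : exists l : seq G,
  forall z, `|p z| <= P -> `|q z| <= Q -> z \in l.
Proof.
have [qu qv pu pv] := And4 (strip_qu S) (strip_qv S) (strip_pu S) (strip_pv S).
pose D := p u * q v - p v * q u.
have D0 : 0 < D.
  by rewrite subr_gt0 (@lt_trans _ _ 0) ?mulr_gt0 // pmulr_rlt0.
have [l1 Hl1] := int_bounded ((q v * P + p v * Q) / D).
have [l2 Hl2] := int_bounded ((- q u * P + p u * Q) / D).
exists [seq u *~ m + v *~ n | m <- l1, n <- l2] => z zP zQ.
have [m [n zE]] := strip_gen S z.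
have pE : p z = m%:~R * p u + n%:~R * p v.
  by rewrite zE raddfD !raddfMz -[p u *~ m]mulrzl -[p v *~ n]mulrzl.
have qE : q z = m%:~R * q u + n%:~R * q v.
  by rewrite zE raddfD !raddfMz -[q u *~ m]mulrzl -[q v *~ n]mulrzl.
rewrite zE; apply: allpairs_f.
- apply: Hl1; rewrite ler_pdivlMr // -(gtr0_norm D0) -normrM.
  have -> : m%:~R * D = q v * p z - p v * q z by rewrite pE qE /D; ring.
  apply: le_trans (ler_normB _ _) _; rewrite !normrM (gtr0_norm qv) (gtr0_norm pv).
  by apply: lerD; rewrite ler_pM2l.
- apply: Hl2; rewrite ler_pdivlMr // -(gtr0_norm D0) -normrM.
  have -> : n%:~R * D = - q u * p z + p u * q z by rewrite pE qE /D; ring.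
  apply: le_trans (ler_normD _ _) _; rewrite !normrM normrN.
  rewrite (ltr0_norm qu) (gtr0_norm pu).
  by apply: lerD; rewrite ler_pM2l ?oppr_gt0.
Qed.

(* The parameters of the translates approximating [T], normalised to a bounded
   region by the lattice, converge along an ultrafilter. *)
Lemma hull_strip C0 s0 x0 T : is_cut q C0 s0 ->
  hull (strip_tiling p u v len C0 x0) T ->
  exists C s x, is_cut q C s /\ T = strip_tiling p u v len C x.
Proof.
move=> cutC0 /hullP hT; set T0 := strip_tiling p u v len C0 x0 in hT *.
pose K := q v - q u; pose L := len false + len true.
(* [f y] is a vertex near the origin in the translate by [y]; taking it as origin bounds the
   parameters. *)
have [f fP] : {f : R -> G & forall y,
    `|s0 + q (f y)| <= K /\ `|x0 + y + p (f y)| <= L}.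
  apply: (@choice R G
    (fun y z => `|s0 + q z| <= K /\ `|x0 + y + p z| <= L)) => y.
  have [t [z Vz tE] t0] := strip_cover S cutC0 (x0 + y) 0.
  exists z; split.
    have := vertex_bounds S cutC0 Vz; have := strip_qu S; have := strip_qv S.
    by rewrite ler_norml /K; lra.
  rewrite addrC -tE ler_norml /L; move: t0; have := strip_len_gt0 S true.
  by have := strip_len_gt0 S false; case: t.1; lra.
pose Cy y := translate_set C0 (f y).
pose sy y := s0 + q (f y); pose xy y := x0 + y + p (f y).
have cutCy y : is_cut q (Cy y) (sy y) by exact: is_cut_translate.
have Ty y : strip_tiling p u v len (Cy y) (xy y) = translate T0 y.
  by rewrite strip_tiling_translate translate_strip_tiling.
pose F := [set Y : set R | exists2 e, 0 < e &
  [set y | close e T (translate T0 y)] `<=` Y].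
have FF : ProperFilter F.
  split; first by move=> [e e0 eF]; have [y /eF] := hT e e0.
  split; first by exists 1.
    move=> Y Z [e e0 eY] [g g0 gZ]; exists (Num.min e g).
      by rewrite lt_min e0 g0.
    have m0 : 0 < Num.min e g by rewrite lt_min e0 g0.
    move=> y cl; split; [apply: eY|apply: gZ]; apply: close_le cl => //.
      by rewrite ge_min lexx.
    by rewrite ge_min lexx orbT.
  by move=> Y Z YZ [e e0 eY]; exists e => // y /eY /YZ.
have [U [UU FU]] := ultraFilterLemma FF.
have lim (g : R -> R) (B : R) : (forall y, `|g y| <= B) ->
    exists l, forall r, 0 < r -> U [set y | `|l - g y| < r].
  move=> gB; have := @segment_compact R (- B) B.
  have UB : U (g @^-1` [set` `[- B, B]]).
    have -> : g @^-1` [set` `[- B, B]] = setT.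
      apply/seteqP; split=> // y _; have := gB y.
      by rewrite ler_norml /= in_itv.
    exact: filterT.
  move=> /(_ (g @ U) _ UB)[l [_ gl]]; exists l => r r0.
  have [//|nU] := in_ultra_setVsetC [set y | `|l - g y| < r] UU.
  have gU : (g @ U) [set a | ~ `|l - a| < r] := nU.
  by have [a [/= nla]] := gl _ _ gU (nbhsx_ballx l r r0); rewrite -ball_normE.
have [s Us] := lim sy K (fun y => (fP y).1).
have [x Ux] := lim xy L (fun y => (fP y).2).
(* The limit cut along the ultrafilter. *)
pose C : set G := [set z | U [set y | Cy y z]].
have cutC : is_cut q C s.
  move=> z; split=> zs.
    apply: filterS (Us _ zs) => y /=; rewrite ltr_norml => ys.
    by apply: (cutCy y z).1; lra.
  move=> Cz; have zs' : 0 < - (q z + s) by lra.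
  have [y [/= ys Cyz]] := filter_ex (filterI (Us _ zs') Cz).
  by move: Cyz; apply: (cutCy y z).2; move: ys; rewrite ltr_norml; lra.
have UC z : U [set y | C z <-> Cy y z].
  have [Cz|nCz] := in_ultra_setVsetC [set y | Cy y z] UU.
    by apply: filterS (Cz) => y Cyz; split.
  apply: filterS (nCz) => y nCyz; split=> // Cz.
  by have [y' []] := filter_ex (filterI Cz nCz).
have Ur r : 0 < r -> U [set y | near_cuts p r C s x (Cy y) (sy y) (xy y)].
  (* Agreement along [U] is required at the finitely many points of [l] only. At any other [z] in
     range, [q z + s] exceeds 1 in absolute value and its sign decides both cuts. *)
  move=> r0; have [l Hl] := strip_finite (r^-1 + `|x|) (1 + `|s|).
  have Ul : U [set y | forall z, z \in l -> (C z <-> Cy y z)].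
    elim: l {Hl} => [|z l IH]; first exact: filterE.
    apply: filterS (filterI (UC z) IH) => y [/= ? h] z'.
    by rewrite inE => /predU1P[->//|/h].
  apply: filterS (filterI (filterI Ul (Us _ r0))
    (filterI (Ux _ r0) (Us _ ltr01))) => y [[/= yl ys] [/= yx ys1]]; split=> // z zr.
  have [zl|zl] := boolP (z \in l); first exact: yl.
  have : 1 < `|q z + s|.
    rewrite ltNge; apply: contra zl => zs; apply: Hl.
      rewrite -[p z](addrK x); apply: le_trans (ler_normB _ _) _.
      by rewrite lerD2r ltW.
    rewrite -[q z](addrK s); apply: le_trans (ler_normB _ _) _.
    by rewrite lerD2r.
  move: ys1; rewrite ltr_norml ltr_normr => /andP[? ?] /orP[?|?].
    by split=> _; [apply: (cutCy y z).1|apply: (cutC z).1]; lra.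
  by split=> h; exfalso; [apply: ((cutC z).2 _ h)|apply: ((cutCy y z).2 _ h)];
    lra.
exists C, s, x; split=> //; apply: (close_all_eq (strip_len_gt0 S)).
  by move=> t t'; exact: (strip_tiling_overlap S cutC).
move=> e e0; pose d := Num.min (e / 3) (1 / 2).
have d0 : 0 < d by rewrite lt_min; apply/andP; split; lra.
have pE z : p z = p z + 0 * q z by rewrite mul0r addr0.
have [r r0 Hr] := near_close S pE d0.
have UT : U [set y | close d T (translate T0 y)] by apply: FU; exists d.
have [y [/= Ty1 nr]] := filter_ex (filterI UT (Ur r r0)).
apply: (close_split e0 Ty1); apply: close_sym.
by have := Hr _ _ _ _ _ _ cutC (cutCy y) nr; rewrite !mul0r !addr0 Ty.
Qed.

End Hull.

(** * Families of tilings with common parameters *)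

Section Transfer.
Context {R : realType} {P : Type}.

Definition separates (I : finType) (len : I -> R) (F : P -> tileset len) : Prop :=
  forall a b, (forall e, 0 < e -> close e (F a) (F b)) -> F a = F b.

(** Uniform continuity of the map from [F a] to [F' a], written on parameters because a tiling may
    have several. *)
Definition uniformly_finer (I J : finType) (len : I -> R) (len' : J -> R)
    (F : P -> tileset len) (F' : P -> tileset len') : Prop :=
  forall e, 0 < e -> exists2 d, 0 < d &
    forall a b, close d (F a) (F b) -> close e (F' a) (F' b).

Section Half.
Context {I J : finType} {len : I -> R} {len' : J -> R}.
Context (F : P -> tileset len) (F' : P -> tileset len') (act : P -> R -> P).
Context (FF' : uniformly_finer F F') (F'sep : separates F').
Context (Fact : forall a x, translate (F a) x = F (act a x)).
Context (F'act : forall a x, translate (F' a) x = F' (act a x)).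
Context (a0 : P) (hullF : hull (F a0) `<=` range F).
Context (k : tileset len -> P) (kP : forall a, F (k (F a)) = F a).

(** The value does not depend on the parameter chosen by [k]: two parameters of one tiling have
    arbitrarily close images, equal by separation. *)
Lemma transferE a : F' (k (F a)) = F' a.
Proof.
apply: F'sep => e e0; have [d d0 Hd] := FF' e0.
by apply: Hd; rewrite kP; exact: close_refl.
Qed.

Lemma transfer_hull : set_fun (hull (F a0)) (hull (F' a0)) (F' \o k).
Proof.
move=> T /[dup] /hullF[a _ <-] /hullP hT; apply/hullP => e e0 /=.
have [d d0 Hd] := FF' e0; have [y ay] := hT d d0.
by exists y; rewrite transferE F'act; apply: Hd; rewrite -Fact.
Qed.

Lemma transfer_continuous : {within hull (F a0), continuous (F' \o k)}.
Proof.
apply/subspace_continuousP => T /hullF[a _ <-] B /=.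
move=> /nbhs_close_sub[e e0 eB]; have [d d0 Hd] := FF' e0.
apply: filterS (nbhs_close (F a) d0) => T' aT' /hullF[b _ bE].
rewrite -bE in aT' *; apply: eB; rewrite /from_subspace /= !transferE.
exact: Hd.
Qed.

End Half.

Lemma conjugate_transfer (I J : finType) (len : I -> R) (len' : J -> R)
    (F : P -> tileset len) (F' : P -> tileset len') (act : P -> R -> P) (a0 : P) :
  uniformly_finer F F' -> uniformly_finer F' F ->
  separates F -> separates F' ->
  (forall a x, translate (F a) x = F (act a x)) ->
  (forall a x, translate (F' a) x = F' (act a x)) ->
  hull (F a0) `<=` range F -> hull (F' a0) `<=` range F' ->
  conjugate_spaces (hull (F a0)) (hull (F' a0)).
Proof.
move=> FF' F'F sF sF' Fact F'act hF hF'.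
have inv (K : finType) (l : K -> R) (H : P -> tileset l) :
    {k : tileset l -> P | forall a, H (k (H a)) = H a}.
  have [|k kP] := @choice (tileset l) P (fun T a => (exists b, H b = T) -> H a = T).
    move=> T; have [[b bT]|nT] := pselect (exists b, H b = T); first by exists b.
    by exists a0.
  by exists k => a; apply: kP; exists a.
have [k kP] := inv _ _ F; have [k' k'P] := inv _ _ F'.
exists (F' \o k); last first.
  by move=> T x /hF[a _ <-] /=; rewrite Fact !(transferE FF' sF' kP) F'act.
exists (F \o k'); split.
- exact: (transfer_hull FF' sF' Fact F'act hF kP).
- exact: (transfer_hull F'F sF F'act Fact hF' k'P).
- split=> T.
    by move=> /hF[a _ <-] /=; rewrite (transferE FF' sF' kP) (transferE F'F sF k'P).
  by move=> /hF'[a _ <-] /=; rewrite (transferE F'F sF k'P) (transferE FF' sF' kP).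
- exact: (transfer_continuous FF' sF' hF kP).
- exact: (transfer_continuous F'F sF hF' k'P).
Qed.

End Transfer.

Section Conjugacy.
Context {R : realType} {G : zmodType}.

Lemma strip_uniform (q p p' : {additive G -> R}) (u v u' v' : G)
    (len len' : bool -> R) (kappa e : R) :
  strip q p u v len -> strip q p' u' v' len' ->
  (forall r, 0 < r -> exists z, 0 < q z < r) -> injective p ->
  (forall z, p' z = p z + kappa * q z) -> 0 < e ->
  exists2 d, 0 < d & forall C s x C' s' x', is_cut q C s -> is_cut q C' s' ->
    close d (strip_tiling p u v len C x) (strip_tiling p u v len C' x') ->
    close e (strip_tiling p' u' v' len' C (x + kappa * s))
      (strip_tiling p' u' v' len' C' (x' + kappa * s')).
Proof.
move=> S S' qd pinj pE e0; have [r r0 Hr] := near_close S' pE e0.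
have [d d0 Hd] := close_near S qd pinj r0; exists d => // C s x C' s' x' cC cC'.
move=> /(Hd _ _ _ _ _ _ cC cC')[y /Hr - /(_ cC (is_cut_translate y cC'))].
rewrite (_ : _ + kappa * (s' + _) = (x' + kappa * s') + p' y).
  by rewrite strip_tiling_translate.
by rewrite pE; ring.
Qed.

Lemma strip_separated (q p : {additive G -> R}) (u v : G) (len : bool -> R)
    C s x (T : tileset len) :
  strip q p u v len -> is_cut q C s ->
  (forall e, 0 < e -> close e T (strip_tiling p u v len C x)) ->
  T = strip_tiling p u v len C x.
Proof.
move=> S cutC; apply: (close_all_eq (strip_len_gt0 S)) => t t'.
exact: (strip_tiling_overlap S cutC).
Qed.

(** Both families are parametrised by [(C, s, x)]. A lattice point moves by [kappa * (q z + s)],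
    which is invariant under lattice shifts of the parameters and independent of [x]; hence the map
    commutes with translations. *)
Lemma strip_conjugate (q p p' : {additive G -> R}) (u v u' v' : G)
    (len len' : bool -> R) (kappa : R) (C0 : set G) (s0 x0 : R) :
  strip q p u v len -> strip q p' u' v' len' ->
  (forall r, 0 < r -> exists z, 0 < q z < r) -> injective p -> injective p' ->
  (forall z, p' z = p z + kappa * q z) -> is_cut q C0 s0 ->
  conjugate_spaces (hull (strip_tiling p u v len C0 x0))
    (hull (strip_tiling p' u' v' len' C0 (x0 + kappa * s0))).
Proof.
move=> S S' qd pinj p'inj pE cutC0.
pose P := {a : set G * R * R | is_cut q a.1.1 a.1.2}.
pose F (a : P) := strip_tiling p u v len (sval a).1.1 (sval a).2.
pose F' (a : P) := strip_tiling p' u' v' len' (sval a).1.1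
  ((sval a).2 + kappa * (sval a).1.2).
pose act (a : P) y : P := exist _ ((sval a).1, (sval a).2 + y) (svalP a).
pose a0 : P := exist _ (C0, s0, x0) cutC0.
apply: (@conjugate_transfer _ _ _ _ _ _ F F' act a0).
- move=> e e0; have [d d0 Hd] := strip_uniform S S' qd pinj pE e0.
  by exists d => // a b; apply: (Hd _ _ _ _ _ _ (svalP a) (svalP b)).
- have pE' z : p z = p' z + - kappa * q z by rewrite pE; ring.
  move=> e e0; have [d d0 Hd] := strip_uniform S' S qd p'inj pE' e0.
  exists d => // a b /(Hd _ _ _ _ _ _ (svalP a) (svalP b)).
  by rewrite !mulNr !addrK.
- by move=> a b; apply: strip_separated (svalP b).
- by move=> a b; apply: strip_separated (svalP b).
- by move=> a x; rewrite translate_strip_tiling.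
- by move=> a x; rewrite translate_strip_tiling /F' /= addrAC.
- move=> T /(hull_strip S cutC0)[C [s [x [cutC ->]]]].
  by exists (exist _ (C, s, x) cutC).
- move=> T /(hull_strip S' cutC0)[C [s [x [cutC ->]]]].
  by exists (exist _ (C, s, x - kappa * s) cutC); rewrite // /F' /= subrK.
Qed.

End Conjugacy.

(** * The canonical tiling *)

Section Lattice.
Context {R : realType}.

Definition lin_fun (a b : R) (z : int * int) : R := z.1%:~R * a + z.2%:~R * b.

Lemma lin_is_zmod_morphism a b : zmod_morphism (lin_fun a b).
Proof. by move=> [x1 x2] [y1 y2]; rewrite /lin_fun /= !intrD !intrN; ring. Qed.

HB.instance Definition _ a b := GRing.isZmodMorphism.Build (int * int)%type R
  (lin_fun a b) (lin_is_zmod_morphism a b).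

Definition lin (a b : R) : {additive (int * int)%type -> R} := lin_fun a b.

Lemma linE a b z : lin a b z = z.1%:~R * a + z.2%:~R * b.
Proof. by []. Qed.

Lemma irrational_lin_eq0 (x : R) (m n : int) : irrational x ->
  m%:~R * x + n%:~R = 0 -> m = 0 /\ n = 0.
Proof.
move=> irr mn; have m0 : m = 0.
  have [//|m0] := eqVneq m 0; exfalso; apply: irr; exists (- n%:~R / m%:~R) => //.
  rewrite fmorph_div rmorphN /= !ratr_int; apply: (mulIf (x := m%:~R)).
    by rewrite intr_eq0.
  by rewrite divfK ?intr_eq0 // mulrC; lra.
by split=> //; move: mn; rewrite m0 mul0r add0r => /eqP; rewrite intr_eq0 => /eqP.
Qed.

Lemma lin_inj (a b : R) :
  (forall m n : int, m%:~R * a + n%:~R * b = 0 -> m = 0 /\ n = 0) ->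
  injective (lin a b).
Proof.
move=> ab z z' /eqP; rewrite -subr_eq0 -raddfB => /eqP/ab[].
case: z z' => [x1 x2] [y1 y2] /= /eqP; rewrite subr_eq0 => /eqP -> /eqP.
by rewrite subr_eq0 => /eqP ->.
Qed.

Lemma int_pair_mulz (y : int * int) (k : int) : y *~ k = (y.1 * k, y.2 * k).
Proof.
have E (n : nat) : y *+ n = (y.1 * n%:Z, y.2 * n%:Z).
  elim: n => [|n IH]; first by rewrite !mulr0.
  by rewrite mulrS IH intS !mulrDr !mulr1.
case: k => n; first exact: E.
by rewrite NegzE mulrNz !mulrN -[_ *~ _]/(_ *+ n.+1) E.
Qed.

Definition det2 (x : (int * int) * (int * int)) : int :=
  x.1.1 * x.2.2 - x.1.2 * x.2.1.

Lemma det2_basis x z : det2 x = 1 ->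
  exists m n : int, z = x.1 *~ m + x.2 *~ n.
Proof.
case: x z => [[u1 u2] [v1 v2]] [z1 z2]; rewrite /det2 /= => d.
exists (z1 * v2 - z2 * v1), (u1 * z2 - u2 * z1); rewrite !int_pair_mulz /=.
have -> (k l m n : int) : (k, l) + (m, n) = (k + m, l + n) by [].
congr pair; [rewrite -{1}[z1]mulr1 -d|rewrite -{1}[z2]mulr1 -d]; ring.
Qed.

End Lattice.

Section CanonicalStrip.
Context {R : realType} (alpha : R) (alpha01 : 0 < alpha < 1).
Context (irr : irrational alpha).

Local Notation nu := (Num.sqrt (1 + alpha ^+ 2)).
Local Notation q := (lin (- alpha) 1).
Local Notation p := (lin nu^-1 (alpha / nu)).

Lemma canonical_norm_gt0 : 0 < nu.
Proof. by rewrite sqrtr_gt0 ltr_pwDl // sqr_ge0. Qed.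

Lemma canonical_strip : strip q p (1, 0) (0, 1) (canonical_len alpha).
Proof.
have nu0 := canonical_norm_gt0; have nui : 0 < nu^-1 by rewrite invr_gt0.
have /andP[a0 a1] := alpha01; split;
  rewrite ?linE /canonical_len /= ?mul1r ?mul0r ?addr0 ?add0r //; try lra.
- by move=> z; apply: (@det2_basis ((1, 0), (0, 1))).
- apply: lin_inj => m n mn.
  have [|-> /eqP] := @irrational_lin_eq0 R alpha m (- n) irr.
    by rewrite intrN; lra.
  by rewrite oppr_eq0 => /eqP ->.
- exact: divr_gt0.
Qed.

Lemma canonical_inj : injective p.
Proof.
apply: lin_inj => m n mn; have [|-> ->//] := @irrational_lin_eq0 R alpha n m irr.
apply: (mulIf (x := nu^-1)); first by rewrite invr_eq0 gt_eqF ?canonical_norm_gt0.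
by rewrite mul0r -mn; ring.
Qed.

Lemma windowP (z : int * int) :
  window alpha (pr2 alpha (z.1%:~R, z.2%:~R)) <-> - alpha <= q z <= 1.
Proof.
have nu0 := canonical_norm_gt0; have /andP[a0 a1] := alpha01.
have pr2E x y : pr2 alpha (x, y) = (y - alpha * x) / nu by [].
have -> : q z = z.2%:~R - alpha * z.1%:~R by rewrite linE; ring.
set w := _ - _; split.
  move=> [[x y] [/=]]; rewrite !in_itv /= => /andP[x0 x1] /andP[y0 y1].
  have nz : nu^-1 != 0 by rewrite invr_eq0 gt_eqF.
  rewrite !pr2E -/w => /(mulIf nz) wE.
  have ax : alpha * x <= alpha by rewrite ler_piMr //; lra.
  have ax0 : 0 <= alpha * x by rewrite mulr_ge0 //; lra.
  by apply/andP; split; lra.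
(* The two sides of the square through the origin already project onto the window. *)
move=> /andP[w0 w1]; have [h|h] := lerP 0 w.
  exists (0, w); first by rewrite /= !in_itv /= lexx ler01 h w1.
  by rewrite !pr2E mulr0 subr0.
exists (- w / alpha, 0); last first.
  by rewrite !pr2E [alpha * _]mulrC divfK ?gt_eqF // sub0r opprK.
have wa : 0 <= - w / alpha by rewrite divr_ge0 ?oppr_ge0 ?ltW.
by rewrite /= !in_itv /= lexx ler01 ler_pdivrMr // mul1r wa; lra.
Qed.

(** In terms of [q] the window is [[- alpha, 1]]. The end 1 is attained at [(0, 1)] only, which is
    dropped; the rest splits at 0 into the vertices labelled true and those labelled false. *)
Lemma verticesP y : vertices alpha y <->
  exists i z, vertex (1, 0) (0, 1) [set z | 0 <= q z] i z /\ y = p z.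
Proof.
have q_inj := strip_inj canonical_strip; have /andP[a0 a1] := alpha01.
have pE (z : int * int) : pr1 alpha (z.1%:~R, z.2%:~R) = p z.
  by rewrite /pr1 linE /=; ring.
have q01 : q (0, 1) = 1 by rewrite !linE /=; ring.
have q10 : q (1, 0) = - alpha by rewrite !linE /=; ring.
split=> [[z [/windowP/andP[q0 q1] z1] <-]|].
  have qn1 : q z != 1.
    by apply/eqP => qE; apply: z1; apply: q_inj; rewrite qE; exact/esym.
  have {}q1 : q z < 1 by rewrite lt_neqAle qn1.
  rewrite pE; have [h|h] := lerP 0 (q z).
    exists false, z; split=> //; split=> //=.
    by rewrite raddfB q01; lra.
  exists true, z; split=> //; split=> /=; first by apply/negP; rewrite -ltNge.
  by rewrite raddfB q10; lra.
move=> [i [z [Vz ->]]]; exists z; last exact: pE.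
have [q0 q1] : - alpha <= q z /\ q z < 1.
  case: i Vz => -[/=].
    by rewrite raddfB q10 => /negP; rewrite -ltNge; lra.
  by rewrite raddfB q01 => + /negP; rewrite -ltNge; lra.
split; first by apply/windowP; lra.
by move=> zE; move: q1; rewrite zE q01 ltxx.
Qed.

Lemma canonical_tilingE : canonical_tiling alpha =
  strip_tiling p (1, 0) (0, 1) (canonical_len alpha) [set z | 0 <= q z] 0.
Proof.
have S := canonical_strip; set C := [set z | 0 <= q z].
have cutC : is_cut q C 0.
  by move=> z; rewrite addr0; split=> h; [exact: ltW|apply/negP; rewrite -ltNge].
have over := strip_tiling_overlap S cutC (x := 0).
have len_gt0 := strip_len_gt0 S.
have vP y : vertices alpha y <->
    exists i, strip_tiling p (1, 0) (0, 1) (canonical_len alpha) C 0 (i, y).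
  split=> [/verticesP[i [z [Vz yE]]]|[i [z Vz yE]]].
    by exists i, z => //; rewrite addr0.
  by apply/verticesP; exists i, z; split=> //; rewrite -[LHS]/(i, y).2 yE addr0.
have next i y : strip_tiling p (1, 0) (0, 1) (canonical_len alpha) C 0 (i, y) ->
    vertices alpha (y + canonical_len alpha i).
  move=> [z Vz yE]; have [j Vj] := vertex_next S cutC Vz.
  apply/vP; exists j, (z + if i then (0, 1) else (1, 0)) => //=.
  by rewrite raddfD (strip_p_step S) -[y]/(i, y).2 yE addr0 addr0.
have between i y w : strip_tiling p (1, 0) (0, 1) (canonical_len alpha) C 0 (i, y) ->
    vertices alpha w -> ~ (y < w < y + canonical_len alpha i).
  move=> Ty /vP[j Tw] /andP[yw wy]; have lj := len_gt0 j.
  have h : y < w + canonical_len alpha j by lra.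
  by have [_ yE] := over _ _ Ty Tw h wy; move: yw; rewrite yE ltxx.
apply/seteqP; split=> -[i y] /=; last first.
  move=> Ty; split=> /=; first by apply/vP; exists i.
    exact: next.
  by move=> w Vw; exact: between Ty Vw.
move=> [/= /vP[j Ty] Vl btw]; suff -> : i = j by [].
(* With different lengths the shorter tile would end at a vertex strictly inside the longer one.
   Equal lengths give equal labels since [alpha < 1]. *)
have lij : canonical_len alpha i = canonical_len alpha j.
  apply/eqP; case: ltgtP => // h; exfalso.
    by apply: (between _ _ _ Ty Vl); rewrite ltrDl ltrD2l h len_gt0.
  by apply: (btw _ (next _ _ Ty)); rewrite ltrDl ltrD2l h len_gt0.
have nu0 := canonical_norm_gt0; have /andP[a0 a1] := alpha01.
move: lij; rewrite /canonical_len => /(mulIf (x := nu^-1)).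
rewrite invr_eq0 gt_eqF // => /(_ isT).
by case: i {Vl btw}; case: j {Ty} => //; lra.
Qed.

End CanonicalStrip.

(** * Self-similar staircases *)

Section Bounds.
Context {R : realType}.

Lemma near_expr_gt (l B : R) : 1 < l -> \forall n \near \oo, B < l ^+ n.
Proof.
move=> l1; have l0 : 0 < l by lra.
have : l^-1 ^+ n @[n --> \oo] --> (0 : R).
  by apply: cvg_expr; rewrite gtr0_norm ?invr_gt0 // invf_lt1.
have B0 : 0 < `|B| + 1 by have := normr_ge0 B; lra.
have Bi : 0 < (`|B| + 1)^-1 by rewrite invr_gt0.
move=> /cvgrPdist_lt /(_ _ Bi); apply: filterS => n.
rewrite sub0r normrN exprVn gtr0_norm ?invr_gt0 ?exprn_gt0 //.
by rewrite ltf_pV2 ?posrE ?exprn_gt0 //; have := ler_norm B; lra.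
Qed.

Lemma finite_set_ub (X : choiceType) (A : set X) (f : X -> R) : finite_set A ->
  exists B, forall a, A a -> f a < B.
Proof.
move=> /finite_seqP[s ->]; elim: s => [|x s [B HB]]; first by exists 0.
exists (Num.max (f x + 1) B) => a /=; rewrite inE lt_max => /predU1P[->|/HB ->].
  by rewrite ltrDl ltr01.
by rewrite orbT.
Qed.

Lemma finite_set_lb (X : choiceType) (A : set X) (f : X -> R) : finite_set A ->
  (forall a, A a -> 0 < f a) -> exists2 r, 0 < r & forall a, A a -> r < f a.
Proof.
move=> finA f0; have [B HB] := finite_set_ub (fun a => (f a)^-1) finA.
have B0 : 0 < Num.max B 1 by rewrite lt_max ltr01 orbT.
exists (Num.max B 1)^-1; first by rewrite invr_gt0.
move=> a Aa; rewrite -[ltRHS]invrK ltf_pV2 ?posrE ?invr_gt0 ?f0 //.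
by rewrite lt_max HB.
Qed.

End Bounds.

Section Inflation.
Context {R : realType} {I : finType} {len : I -> R} (w : substitution len).

Lemma inflate_cover (P : tileset len) (y : R) :
  (exists2 t, P t & t.2 <= y <= t.2 + len t.1) ->
  exists2 t, inflate w P t & t.2 <= factor w * y <= t.2 + len t.1.
Proof.
have f1 := factor_gt1 w; have f0 : 0 < factor w by lra.
move=> [t Pt /andP[ty yt]].
have : (\bigcup_(t' in rule w t.1) @support R I len t') (factor w * (y - t.2)).
  rewrite rule_support /= in_itv /= mulr_ge0 ?subr_ge0 ?(ltW f0) //=.
  by rewrite ler_pM2l //; lra.
move=> [t' rt']; rewrite /support /= in_itv /= => t'y.
exists (t'.1, t'.2 + factor w * t.2); last by rewrite /=; lra.
by exists t => //; apply/translateP; rewrite /= addrK -surjective_pairing.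
Qed.

(** Supertiles have no gaps; this is what makes the inclusion [iterate_strip] reversible. *)
Lemma iterate_cover n i y : 0 <= y <= factor w ^+ n * len i ->
  exists2 t, iterate w n i t & t.2 <= y <= t.2 + len t.1.
Proof.
have f1 := factor_gt1 w; have f0 : 0 < factor w by lra.
elim: n y => [|n IH] y.
  by rewrite expr0 mul1r => yi; exists (i, 0); rewrite //= add0r.
move=> yn; have [|t] := @inflate_cover (iterate w n i) (y / factor w).
  apply: IH; rewrite divr_ge0 ?(ltW f0) //=; last by case/andP: yn.
  by rewrite ler_pdivrMr // mulrAC -exprSr; case/andP: yn.
by rewrite mulrC divfK ?gt_eqF //; exists t.
Qed.

End Inflation.

Section StripSubstitution.
Context {R : realType} {G : zmodType}.
Context (q p : {additive G -> R}) (u v : G) (len : bool -> R).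
Context (S : strip q p u v len).
Context (eps lam : R) (eps01 : 0 < eps < 1) (lam1 : 1 < lam).
(** The lattice automorphism, given by its effect on [q] and [p]; [unscale] is its surjectivity. *)
Context (scale : forall z, exists2 z', q z' = eps * q z & p z' = lam * p z).
Context (unscale : forall z', exists2 z, q z' = eps * q z & p z' = lam * p z).

(* The two cuts at the origin; the origin starts a tile labelled [c] in the tiling
   of [halfspace c]. *)
Definition halfspace (c : bool) : set G := [set z | if c then 0 < q z else 0 <= q z].

Local Notation T c := (strip_tiling p u v len (halfspace c) 0).

Lemma halfspace_cut c : is_cut q (halfspace c) 0.
Proof.
by case: c => z; rewrite /halfspace /= addr0; split; rewrite //; lra.
Qed.

Let qu := strip_qu S.
Let qv := strip_qv S.

Lemma halfspace0 c : vertex u v (halfspace c) c 0.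
Proof.
by case: c; split; rewrite /halfspace /= ?raddfB raddf0 ?sub0r;
  have := qu; have := qv; lra.
Qed.

(** Take the image of [v] under a high power of the automorphism. *)
Lemma strip_contract r N : 0 < r -> exists2 z, 0 < q z < r & N < p z.
Proof.
move=> r0; have /andP[e0 e1] := eps01.
have scalen n : exists2 z, q z = eps ^+ n * q v & p z = lam ^+ n * p v.
  elim: n => [|n [z qz pz]]; first by exists v; rewrite expr0 mul1r.
  by have [z' qz' pz'] := scale z; exists z'; rewrite ?qz' ?pz' ?qz ?pz exprS mulrA.
have pv0 := strip_pv S; have qv0 := qv.
have e_small : \forall n \near \oo, eps ^+ n < r / q v.
  have : eps ^+ n @[n --> \oo] --> (0 : R) by apply: cvg_expr; rewrite gtr0_norm.
  move=> /cvgrPdist_lt /(_ _ (divr_gt0 r0 qv0)); apply: filterS => n.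
  by rewrite sub0r normrN gtr0_norm ?exprn_gt0.
have l_big : \forall n \near \oo, N / p v < lam ^+ n by exact: near_expr_gt.
have [n [/= en ln]] := filter_ex (filterI e_small l_big).
have [z qz pz] := scalen n; exists z.
  by rewrite qz mulr_gt0 ?exprn_gt0 //= -ltr_pdivlMr.
by rewrite pz -ltr_pdivrMr.
Qed.

Lemma strip_before c x t t' :
  strip_tiling p u v len (halfspace c) x t ->
  strip_tiling p u v len (halfspace c) x t' ->
  t.2 < t'.2 -> t.2 + len t.1 <= t'.2.
Proof.
move=> Tt Tt' tt'; rewrite leNgt; apply/negP => h.
have l0 := strip_len_gt0 S t'.1.
have tE : t = t'.
  by apply: (strip_tiling_overlap S (halfspace_cut c) Tt Tt' _ h); lra.
by move: tt'; rewrite tE ltxx.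
Qed.

(** The image of [v] or [u] under the automorphism is the vertex at which the supertile of [c] ends.
    The opposite label found there also serves primitivity. *)
Lemma strip_scaled_end c : T c (~~ c, lam * len c).
Proof.
have /andP[e0 e1] := eps01; have pu := strip_len0 S; have pv := strip_len1 S.
have qu0 := qu; have qv0 := qv.
case: c; rewrite ?pu ?pv.
  have [z qz <-] := scale v; exists z; rewrite /= ?addr0 //.
  split; rewrite /halfspace /= ?raddfB ?qz; first by rewrite mulr_gt0.
  by rewrite subr_gt0 -[ltLHS]mul1r ltr_pM2r // ; lra.
have [z qz <-] := scale u; exists z; rewrite /= ?addr0 //.
have z0 : eps * q u < 0 by rewrite pmulr_rlt0.
have z1 : q u < eps * q u by rewrite -[ltLHS]mul1r ltr_nM2r.
by split; rewrite /halfspace /= ?raddfB ?qz; lra.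
Qed.

Definition strip_rule (i : bool) : tileset len :=
  [set t | T i t /\ 0 <= t.2 < lam * len i].

Lemma strip_rule_support i :
  \bigcup_(t in strip_rule i) @support R _ len t = `[0, lam * len i]%classic.
Proof.
have l0 := strip_len_gt0 S i; have ll0 : 0 < lam * len i.
  by rewrite mulr_gt0 // (lt_trans ltr01).
have Ti0 : T i (i, 0) by exists 0; [exact: halfspace0|rewrite raddf0 addr0].
apply/seteqP; split=> y.
  move=> [t [Tt /andP[t0 tl]]]; rewrite /support /= !in_itv /= => /andP[ty yt].
  by have /= := strip_before Tt (strip_scaled_end i) tl; lra.
(* [strip_cover] leaves out the left end of a tile, so [y = 0] is treated apart. *)
rewrite /= in_itv /= => /andP[]; rewrite le_eqVlt => /predU1P[<- _|y0 yl].
  by exists (i, 0); rewrite /strip_rule /support /= ?in_itv /= ?lexx ?add0r ?ltW.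
have [t Tt /andP[ty yt]] := strip_cover S (halfspace_cut i) 0 y.
exists t; last by rewrite /support /= in_itv /= ltW.
split=> //; apply/andP; split; last by lra.
rewrite leNgt; apply/negP => t0.
by have /= := strip_before Tt Ti0 t0; lra.
Qed.

Lemma strip_rule_finite i : finite_set (strip_rule i).
Proof.
have [l Hl] := strip_finite S (lam * len i) (q v - q u).
apply: (@sub_finite_set _ _
  ((fun jz : bool * G => (jz.1, p jz.2)) @` ([set: bool] `*` [set` l]))).
  move=> [j y] [[z /= Vz yE] /andP[/= y0 yl]].
  have := vertex_bounds S (halfspace_cut i) Vz; rewrite addr0 => qz.
  rewrite addr0 in yE; exists (j, z); rewrite /= ?yE //; split=> //=.
  have [qu0 qv0] := (qu, qv); apply: Hl; rewrite -?yE ler_norml; lra.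
by apply/finite_image/finite_setX; [exact: finite_finset|exact: finite_seq].
Qed.

Lemma strip_rule_patch i : is_patch (strip_rule i).
Proof.
split; first exact: strip_rule_finite.
  move=> t t' [Tt _] [Tt' _].
  exact: (strip_nonoverlapping S (halfspace_cut i) Tt Tt').
by rewrite strip_rule_support; exact: segment_connected.
Qed.

Definition strip_substitution : substitution len :=
  Substitution (strip_len_gt0 S) lam1 strip_rule_patch strip_rule_support.

Local Notation w := strip_substitution.

(* Scaling maps the vertices of [T c] to points of its lattice; no lattice point
   that would break a supertile lies in the gaps excluded by [strip_gap_u] and
   [strip_gap_v]. *)
Lemma inflate_strip c : inflate w (T c) `<=` T c.
Proof.
have /andP[e0 e1] := eps01; have [qu0 qv0] := (qu, qv).
have pu0 := strip_pu S; have pv0 := strip_pv S; have l1 := lam1.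
have lam0 : 0 < lam by lra.
(* The preimage of [z] under the automorphism would lie in the box of [strip_gap_u]; [lam > 1] makes
   the weak lower bound on [p z] strict. *)
have gap_u x z : 0 <= p z + p v -> p z < lam * p u -> 0 <= x <= q v ->
    - (eps * x) <= q z -> q z < 0 -> False.
  move=> pz1 pz2 /andP[x0 x1] qz1 qz2; have [z' qE pE] := unscale z.
  have xv : eps * x <= eps * q v by rewrite ler_pM2l.
  apply: (strip_gap_u S (z := z')); apply/andP; split.
  - by rewrite -(ler_pM2l e0) -qE mulrN; lra.
  - by rewrite -(pmulr_rlt0 _ e0) -qE.
  - rewrite -(ltr_pM2l lam0) -pE mulrN.
    by have : 1 * p v < lam * p v by [rewrite ltr_pM2r]; lra.
  - by rewrite -(ltr_pM2l lam0) -pE.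
have gap_v x z : 0 <= p z + p u -> p z < lam * p v -> q u <= x <= 0 ->
    0 < q z -> q z <= - (eps * x) -> False.
  move=> pz1 pz2 /andP[x0 x1] qz1 qz2; have [z' qE pE] := unscale z.
  have xu : eps * q u <= eps * x by rewrite ler_pM2l.
  apply: (strip_gap_v S (z := z')); apply/andP; split.
  - by rewrite -(pmulr_rgt0 _ e0) -qE.
  - by rewrite -(ler_pM2l e0) -qE mulrN; lra.
  - rewrite -(ltr_pM2l lam0) -pE mulrN.
    by have : 1 * p u < lam * p u by [rewrite ltr_pM2r]; lra.
  - by rewrite -(ltr_pM2l lam0) -pE.
move=> [j y] [[i x] [z /= Vz xE] /translateP /= [[a /= Va yE] /andP[/= y0 yl]]].
rewrite addr0 in xE; rewrite addr0 in yE; have [z' qz' pz'] := scale z.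
exists (a + z'); last by rewrite /= addr0 raddfD pz' -yE xE; ring.
(* The tile at the origin is labelled [c], and its supertile is taken from [T c] itself. *)
have [z0|z0] := eqVneq z 0.
  have -> : z' = 0 by apply: (strip_inj S); rewrite qz' z0 raddf0 mulr0.
  have -> : c = i; last by rewrite addr0.
  by rewrite z0 in Vz; exact: vertex_label (halfspace0 c) Vz.
have qz0 : q z != 0.
  by apply: contra z0 => /eqP qz; apply/eqP/(strip_inj S); rewrite qz raddf0.
rewrite yE in y0 yl.
have [qzi qzp] : [/\ q u <= q z <= q v & if i then q z < 0 else 0 < q z].
  have := vertex_bounds S (halfspace_cut c) Vz; rewrite addr0 => ->; split=> //.
  have [h|h|/eqP] := ltgtP (q z) 0; last by rewrite (negPf qz0).
    by case: i Vz {Va yl} => // -[]; rewrite /halfspace;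
      case: (c) => /= *; exfalso; lra.
  by case: i Vz {Va yl} => // -[]; rewrite /halfspace;
      case: (c) => /= *; exfalso; lra.
have eqz : if i then eps * q z < 0 else 0 < eps * q z.
  by move: qzp; case: i {Vz Va yl}; rewrite ?pmulr_rlt0 ?pmulr_rgt0.
(* One inequality follows from the sign of [q z], the other from a gap. Both are strict and so suit
   either value of [c]. *)
suff Vq : if j then q a + eps * q z < 0 /\ 0 < q a - q u + eps * q z
    else 0 < q a + eps * q z /\ q a - q v + eps * q z < 0.
  move: Vq; rewrite /vertex /halfspace; case: (j) => -[h1 h2];
  split; rewrite /= !(raddfB, raddfD) qz'; case: (c); lra.
move: Va yl eqz qzp qzi; case: i {Vz}; rewrite ?(strip_len0 S) ?(strip_len1 S);
  case: j => -[] /=; rewrite /halfspace /= !raddfB => a1 a2 yl ez qzp qzi;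
  split; try lra.
- rewrite ltNge; apply/negP => h; apply: (gap_v (q z) (a - u));
    rewrite ?raddfB ?subrK; lra.
- by rewrite ltNge; apply/negP => h; apply: (gap_v (q z) a); lra.
- by rewrite ltNge; apply/negP => h; apply: (gap_u (q z) a); lra.
- rewrite ltNge; apply/negP => h; apply: (gap_u (q z) (a - v));
    rewrite ?raddfB ?subrK; lra.
Qed.

Lemma iterate_strip n i : iterate w n i `<=` T i.
Proof.
elim: n => [|n IH] t /=.
  by move=> ->; exists 0; [exact: halfspace0|rewrite raddf0 addr0].
by move=> [t' /IH Tt' tt']; apply: inflate_strip; exists t'.
Qed.

(** The point [y] is interior to [t] and lies in the supertile, so a tile of the iterate covers it.
    That tile belongs to [T i] and overlaps [t], hence equals it. *)
Lemma strip_iterate n i t : T i t -> 0 <= t.2 -> t.2 < lam ^+ n * len i ->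
  iterate w n i t.
Proof.
move=> Tt t0 tl; have lt := strip_len_gt0 S t.1.
pose m := Num.min (lam ^+ n * len i) (t.2 + len t.1).
have tm : t.2 < m by rewrite lt_min tl ltrDl.
have [ml mt] : m <= lam ^+ n * len i /\ m <= t.2 + len t.1.
  by rewrite /m !ge_min !lexx orbT.
pose y := (t.2 + m) / 2.
have [|s Is sy] := @iterate_cover _ _ _ w n i y.
  by apply/andP; rewrite /= /y; split; lra.
suff -> : t = s by [].
by apply: (strip_tiling_overlap S (halfspace_cut i) Tt (iterate_strip Is));
  move: sy; rewrite /y; lra.
Qed.

Lemma strip_primitive : primitive w.
Proof.
(* The tile of the other label given by [strip_scaled_end] starts where the first iterate ends,
   hence inside the second. *)
exists 2 => i j; have l1 := lam1; have lam0 : 0 < lam by lra.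
have li := strip_len_gt0 S i.
have l2 : 0 < lam ^+ 2 * len i by rewrite mulr_gt0 ?exprn_gt0.
have [->|ij] := eqVneq j i.
  exists 0; apply: strip_iterate => //=.
  by exists 0; [exact: halfspace0|rewrite raddf0 addr0].
have -> : j = ~~ i by case: i j ij {li l2} => -[].
exists (lam * len i); apply: strip_iterate; first exact: strip_scaled_end.
  by rewrite /= mulr_ge0 // ltW.
by rewrite /= ltr_pM2r // expr2 ltr_pMr.
Qed.

Lemma strip_generated : generated_by w (T false).
Proof.
have cut0 := halfspace_cut false; have [qu0 qv0] := (qu, qv).
split=> [|P [finP _ _] PT]; first exact: (strip_is_tiling S cut0 0).
(* A lattice vector with small positive image under [q] and large image under [p]
   moves the patch to the right of the origin within the tiling. *)
have [g gP] : {g : bool * R -> G | forall t, P t ->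
    vertex u v (halfspace false) t.1 (g t) /\ t.2 = p (g t)}.
  have [|g gP] := @choice (bool * R)%type G (fun t z => P t ->
      vertex u v (halfspace false) t.1 z /\ t.2 = p z); last by exists g.
  move=> t; have [Pt|nPt] := pselect (P t); last by exists 0.
  by have [z Vz tE] := PT _ Pt; exists z => _; rewrite tE addr0.
(* [f t] is the room for increasing [q] at a vertex without changing its label; it is positive
   because the conditions for [halfspace false] are strict on that side. *)
pose f t := if t.1 then - q (g t) else q v - q (g t).
have [r r0 Hr] : exists2 r, 0 < r & forall t, P t -> r < f t.
  apply: finite_set_lb => // t Pt; have [+ _] := gP t Pt; rewrite /f.
  by case: t.1 => -[]; rewrite /halfspace /= ?raddfB; lra.
have [N HN] := finite_set_ub (fun t => - t.2) finP.
have PN z : 0 < q z < r -> N < p z ->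
    forall t, P t -> T false (t.1, t.2 + p z) /\ 0 <= t.2 + p z.
  move=> zr zN t Pt; split; last by have /= := HN t Pt; lra.
  have [Vt tE] := gP t Pt; have := Hr t Pt; rewrite /f => fr.
  exists (g t + z); last by rewrite /= raddfD tE addr0.
  move: Vt fr; rewrite /vertex /halfspace /= => Vt fr.
  by case: (t.1) Vt fr; rewrite !(raddfB, raddfD) => -[] ? ? ?; split; lra.
have [z zr zN] := strip_contract N r0.
have [n Hn] : exists n, forall t, P t -> t.2 + p z < lam ^+ n * len false.
  have [B HB] := finite_set_ub (fun t => (t.2 + p z) / len false) finP.
  have [n Bn] := filter_ex (near_expr_gt B lam1); exists n => t Pt.
  rewrite -ltr_pdivrMr ?(strip_len_gt0 S) //; exact: lt_trans (HB t Pt) Bn.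
exists n, false, (p z) => t /translateP Pt.
have [/= Tt t0] := PN z zr zN _ Pt; have tl := Hn _ Pt.
by move: Tt t0 tl; rewrite /= subrK -surjective_pairing; exact: strip_iterate.
Qed.

End StripSubstitution.

(** * Quadratic slopes *)

Section Farey.
Context {R : realType} {G : zmodType} (q : {additive G -> R}).
Context (q_inj : injective q).

(** The slow continued fraction algorithm: on a straddling pair, the sum replaces the vector at
    which [q] has the same sign. *)
Definition farey (x : G * G) : G * G :=
  if q (x.1 + x.2) < 0 then (x.1 + x.2, x.2) else (x.1, x.1 + x.2).

Definition straddles (p : G -> R) (m : R) (x : G * G) : Prop :=
  [/\ q x.1 < 0, 0 < q x.2, m <= p x.1 & m <= p x.2].

Variant farey_spec (x : G * G) : G * G -> Prop :=
| FareyLeft of q x.1 + q x.2 < 0 : farey_spec x (x.1 + x.2, x.2)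
| FareyRight of 0 <= q x.1 + q x.2 : farey_spec x (x.1, x.1 + x.2).

Lemma fareyP x : farey_spec x (farey x).
Proof.
by rewrite /farey raddfD; case: ltP => h; constructor.
Qed.

Section Growth.
Context (p : {additive G -> R}) (m : R) (m0 : 0 < m).

Local Notation inv := (straddles p m).

Lemma farey_straddles x : inv x -> inv (farey x).
Proof.
have mp := m0; move=> [x1 x2 p1 p2]; have [h|h] := fareyP x; split=> //=;
  rewrite ?raddfD //=; try lra.
(* [q] does not vanish at the sum, since [p] is positive there and [q] is injective. *)
rewrite lt_neqAle h andbT eq_sym -raddfD; apply/eqP; rewrite -(raddf0 q).
by move=> /q_inj /(congr1 p); rewrite raddfD raddf0; lra.
Qed.

Lemma iter_farey_straddles k x : inv x -> inv (iter k farey x).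
Proof. by move=> ix; elim: k => //= k; exact: farey_straddles. Qed.

Lemma iter_farey_le k x : inv x ->
  p x.1 <= p (iter k farey x).1 /\ p x.2 <= p (iter k farey x).2.
Proof.
move=> ix; have mp := m0; elim: k => //= k [h1 h2].
have := iter_farey_straddles k ix; set y := iter k farey x in h1 h2 *.
by move=> [_ _ y1 y2]; have [h|h] := fareyP y; rewrite /= ?raddfD; split; lra.
Qed.

(** While the first vector stays, each step lowers [q] of the second by [- q x.1], which can happen
    only finitely often; then the first vector gains at least [m]. *)
Lemma farey_grow_left x : inv x -> exists k, p x.1 + m <= p (iter k farey x).1.
Proof.
move=> ix; have q1 : 0 < - q x.1 by case: ix => ? _ _ _; lra.
have [n] : exists n : nat, q x.2 < n%:R * - q x.1.
  exists (Num.bound (q x.2 / - q x.1)); rewrite -ltr_pdivrMr //.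
  by apply: archi_boundP; rewrite divr_ge0 ?ltW //; case: ix.
elim: n x ix {q1} => [|n IH] x ix; have [x1 x2 p1 p2] := ix.
  by rewrite mul0r; lra.
rewrite -natr1 mulrDl mul1r => xn; have fx := farey_straddles ix.
move: fx; case E: (farey x) / (fareyP x) => [h|h] fx.
  by exists 1; rewrite /= E raddfD /=; lra.
have [|k kP] := IH _ fx; first by rewrite /= raddfD; lra.
by exists k.+1; rewrite iterSr E.
Qed.

Lemma farey_grow_right x : inv x -> exists k, p x.2 + m <= p (iter k farey x).2.
Proof.
move=> ix; have q1 : 0 < q x.2 by case: ix.
have [n] : exists n : nat, - q x.1 < n%:R * q x.2.
  exists (Num.bound (- q x.1 / q x.2)); rewrite -ltr_pdivrMr //.
  by apply: archi_boundP; rewrite divr_ge0 ?ltW //; case: ix => ? _ _ _; lra.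
elim: n x ix {q1} => [|n IH] x ix; have [x1 x2 p1 p2] := ix.
  by rewrite mul0r; lra.
rewrite -natr1 mulrDl mul1r => xn; have fx := farey_straddles ix.
move: fx; case E: (farey x) / (fareyP x) => [h|h] fx; last first.
  by exists 1; rewrite /= E raddfD /=; lra.
have [|k kP] := IH _ fx; first by rewrite /= raddfD; lra.
by exists k.+1; rewrite iterSr E.
Qed.

Lemma farey_unbounded B x : inv x -> exists k,
  B < p (iter k farey x).1 /\ B < p (iter k farey x).2.
Proof.
move=> ix; suff H n : exists k, n%:R * m <= p (iter k farey x).1 /\
    n%:R * m <= p (iter k farey x).2.
  have [k kP] := H (Num.bound (`|B| / m)); exists k.
  have : B < (Num.bound (`|B| / m))%:R * m; last by lra.
  rewrite -ltr_pdivrMr //; apply: (@le_lt_trans _ _ (`|B| / m)).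
    by rewrite ler_pM2r ?invr_gt0 // ler_norm.
  by apply: archi_boundP; rewrite divr_ge0 // ltW.
elim: n => [|n [k [k1 k2]]].
  by exists 0; rewrite mul0r /=; have := m0; case: ix => ? ? ? ?; lra.
have ik := iter_farey_straddles k ix.
have [j jP] := farey_grow_left ik; have ij := iter_farey_straddles j ik.
have [l lP] := farey_grow_right ij; exists (l + (j + k))%N.
rewrite !iterD -natr1 mulrDl mul1r.
have := iter_farey_le j ik; have := iter_farey_le l ij; lra.
Qed.

(** This bounds [q] along the algorithm and later yields [eps < 1] and [lam > 1]. *)
Lemma iter_farey_lt k x : inv x ->
  q (iter k.+1 farey x).2 - q (iter k.+1 farey x).1 < q x.2 - q x.1 /\
  p x.1 + p x.2 < p (iter k.+1 farey x).1 + p (iter k.+1 farey x).2.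
Proof.
have step y : inv y -> q (farey y).2 - q (farey y).1 < q y.2 - q y.1 /\
    p y.1 + p y.2 < p (farey y).1 + p (farey y).2.
  move=> [y1 y2 y3 y4]; have mp := m0.
  by have [h|h] := fareyP y; rewrite /= (raddfD q) (raddfD p); lra.
move=> ix; elim: k => [|k IH]; first exact: step.
by have := step _ (iter_farey_straddles k.+1 ix); rewrite -iterS; lra.
Qed.

End Growth.
End Farey.

Lemma pigeonhole_seq (X : eqType) (f : nat -> X) (l : seq X) :
  (forall k, f k \in l) -> exists i j, (i < j)%N /\ f i = f j.
Proof.
move=> fl; apply: contrapT => nf.
have f_inj : injective f.
  move=> i j fij; apply: contrapT => /eqP; rewrite neq_ltn => /orP[] ij; apply: nf.
    by exists i, j.
  by exists j, i.
have := @uniq_leq_size _ (map f (iota 0 (size l).+1)) l.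
rewrite map_inj_uniq // iota_uniq size_map size_iota ltnn => /(_ isT).
by have /[swap] /[apply] : {subset map f (iota 0 (size l).+1) <= l}
  by move=> _ /mapP[k _ ->].
Qed.

(** * Integral binary quadratic forms *)

Section QuadraticForm.

Context (a b c : int).

(* The coefficients, in the basis [x], of the form [a n^2 + b m n + c m^2]. *)
Definition form_coefs (x : (int * int) * (int * int)) : int * int * int :=
  let: (u, v) := x in
  (a * u.2 * u.2 + b * u.1 * u.2 + c * u.1 * u.1,
   2 * a * u.2 * v.2 + b * (u.1 * v.2 + u.2 * v.1) + 2 * c * u.1 * v.1,
   a * v.2 * v.2 + b * v.1 * v.2 + c * v.1 * v.1).

Lemma form_disc x A B C : form_coefs x = (A, B, C) ->
  B * B - 4 * A * C = (b * b - 4 * a * c) * (det2 x * det2 x).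
Proof. by case: x => [[u1 u2] [v1 v2]] [<- <- <-]; rewrite /det2 /=; ring. Qed.

(** As [A * C] is negative, [D] is a sum of the nonnegative terms [B * B] and [- 4 * A * C], which
    bounds all three coefficients. *)
Lemma indefinite_bounded (D : int) : exists l : seq (int * int * int),
  forall A B C : int, A * C < 0 -> B * B - 4 * A * C = D -> (A, B, C) \in l.
Proof.
pose r := [seq k%:Z | k <- iota 0 `|D|.+1] ++ [seq - k%:Z | k <- iota 0 `|D|.+1].
have Hr (m : int) : `|m| <= `|D| -> m \in r.
  move=> mD; rewrite mem_cat; case: (lerP 0 m) => m0; apply/orP; [left|right];
  apply/mapP; exists `|m|%N; rewrite ?mem_iota //; lia.
exists [seq (AB, C) | AB <- [seq (A, B) | A <- r, B <- r], C <- r] => A B C AC E.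
have BB : 0 <= B * B by nia.
have [A0 C0] : A != 0 /\ C != 0.
  by split; apply: contraTneq AC => ->; rewrite ?mul0r ?mulr0.
have [A1 C1] : `|A| <= `|A * C| /\ `|C| <= `|A * C|.
  by rewrite normrM; split; [rewrite ler_peMr|rewrite ler_peMl] => //; lia.
have B1 : `|B| <= B * B by nia.
have ACE : `|A * C| = - (A * C) by lia.
apply: (allpairs_f (fun AB C => (AB, C))); last by apply: Hr; lia.
by apply: allpairs_f; apply: Hr; lia.
Qed.

End QuadraticForm.

Section QuadraticSlope.
Context {R : realType} (alpha : R) (alpha01 : 0 < alpha < 1).
Context (irr : irrational alpha) (a b c : int) (a0 : a != 0).
Context (root : a%:~R * alpha ^+ 2 + b%:~R * alpha + c%:~R = 0).

Local Notation nu := (Num.sqrt (1 + alpha ^+ 2)).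
Local Notation q := (lin (- alpha) 1).
Local Notation p := (lin nu^-1 (alpha / nu)).

(** This is [a] times the difference of [alpha] and its conjugate. *)
Let delta : R := a%:~R * alpha + a%:~R * alpha + b%:~R.
Let g : R := nu / delta.

(* The functional proportional to the Galois conjugate of [q] that takes the same
   value as [p] on the direction [(1, alpha)] of the line. *)
Let p' := lin (g * (b%:~R + a%:~R * alpha)) (g * a%:~R).
Let kappa : R := g * a%:~R - alpha / nu.

Lemma delta_neq0 : delta != 0.
Proof.
apply/eqP => d0; have [|/eqP] := @irrational_lin_eq0 R alpha (a + a) b irr.
  by rewrite intrD mulrDl.
by rewrite -mulr2n mulrn_eq0 (negPf a0).
Qed.

Lemma g_neq0 : g != 0.
Proof.
by rewrite mulf_neq0 ?invr_eq0 ?delta_neq0 // gt_eqF ?canonical_norm_gt0.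
Qed.

Lemma conjugate_inj : injective p'.
Proof.
apply: lin_inj => m n mn.
have [|ma /eqP] := @irrational_lin_eq0 R alpha (m * a) (m * b + n * a) irr.
  apply: (mulfI g_neq0); rewrite mulr0 -[RHS]mn intrD !intrM; ring.
have m0 : m = 0 by move/eqP: ma; rewrite mulf_eq0 (negPf a0) orbF => /eqP.
by rewrite m0 mul0r add0r mulf_eq0 (negPf a0) orbF => /eqP.
Qed.

(** Extended to the plane, [p' - p] and [q] both vanish at [(1, alpha)], so they are proportional;
    [kappa] is their ratio at [(0, 1)]. *)
Lemma conjugateE z : p' z = p z + kappa * q z.
Proof.
rewrite !linE /kappa.
have nu0 : nu != 0 by rewrite gt_eqF // canonical_norm_gt0.
have gd : g * delta = nu by rewrite divfK ?delta_neq0.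
have nn : nu * nu = 1 + alpha * alpha.
  by rewrite -expr2 sqr_sqrtr ?expr2 // ltW // ltr_pwDl // -expr2 sqr_ge0.
have ni : nu = nu^-1 + alpha * alpha / nu.
  by apply: (mulfI nu0); rewrite mulrDr nn [nu * (_ / nu)]mulrC divfK // divff.
have -> : g * (b%:~R + a%:~R * alpha) = nu - g * a%:~R * alpha.
  by rewrite -gd /delta; ring.
by rewrite {1}ni; ring.
Qed.

(** The form factors as [q p' / g], its roots being [alpha] and the conjugate. *)
Lemma form_coefsE u v A B C : form_coefs a b c (u, v) = (A, B, C) ->
  [/\ A%:~R * g = q u * p' u, B%:~R * g = q u * p' v + q v * p' u &
      C%:~R * g = q v * p' v].
Proof.
have cE : c%:~R = - (a%:~R * alpha * alpha + b%:~R * alpha) :> R.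
  by apply/eqP; rewrite -addr_eq0 -[X in _ == X]root expr2; apply/eqP; ring.
by move=> [<- <- <-]; rewrite !linE !(intrD, intrM) cE; split; ring.
Qed.

Lemma straddles_form u v A B C : form_coefs a b c (u, v) = (A, B, C) ->
  q u < 0 < q v -> 0 < p' u -> 0 < p' v -> A * C < 0.
Proof.
move=> /form_coefsE[AE _ CE] /andP[u0 v0] pu pv.
rewrite -(ltrz0 R) intrM.
have gg : 0 < g * g by rewrite -expr2 exprn_even_gt0 //= g_neq0.
rewrite -(pmulr_llt0 _ gg) mulrACA AE CE pmulr_llt0 ?pmulr_llt0 //.
  by rewrite mulr_gt0.
Qed.

(** The ratios [q v / q u] and [p' v / p' u] are the roots of [A X^2 - B X + C]. Their signs tell
    them apart, so the coefficients determine each. *)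
Lemma form_coefs_ratio u v u' v' :
  form_coefs a b c (u, v) = form_coefs a b c (u', v') ->
  q u < 0 < q v -> q u' < 0 < q v' ->
  0 < p' u -> 0 < p' v -> 0 < p' u' -> 0 < p' v' ->
  q v' * q u = q v * q u' /\ p' v' * p' u = p' v * p' u'.
Proof.
move=> E /andP[u0 v0] /andP[u'0 v'0] pu pv pu' pv'.
case E' : (form_coefs a b c (u', v')) => [[A B] C]; rewrite E' in E.
have [A1 B1 C1] := form_coefsE E'; have [+ + +] := form_coefsE E.
rewrite A1 B1 C1 => {}A1 {}B1 {}C1.
pose x := q v / q u; pose y := p' v / p' u.
pose x' := q v' / q u'; pose y' := p' v' / p' u'.
have [nu0 nu0' npu npu'] : [/\ q u != 0, q u' != 0, p' u != 0 & p' u' != 0].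
  by split; [rewrite lt_eqF|rewrite lt_eqF|rewrite gt_eqF|rewrite gt_eqF].
have [qvE pvE qv'E pv'E] : [/\ q v = x * q u, p' v = y * p' u,
    q v' = x' * q u' & p' v' = y' * p' u'] by rewrite /x /y /x' /y' !divfK.
move: B1 C1; rewrite qvE pvE qv'E pv'E => B1 C1.
have quu : q u * p' u != 0 by rewrite mulf_neq0.
have sE : x + y = x' + y'.
  apply: (mulfI quu); rewrite -{2}A1.
  transitivity (q u * (y * p' u) + x * q u * p' u); first by ring.
  by rewrite -B1; ring.
have mE : x * y = x' * y'.
  apply: (mulfI quu); rewrite -{2}A1.
  transitivity (x * q u * (y * p' u)); first by ring.
  by rewrite -C1; ring.
have x0 : x < 0 by rewrite /x pmulr_rlt0 // invr_lt0.
have y'0 : 0 < y' by rewrite divr_gt0.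
have /eqP : (x - x') * (x - y') = 0.
  transitivity (x * x - x * (x' + y') + x' * y'); first by ring.
  by rewrite -sE -mE; ring.
rewrite mulf_eq0 !subr_eq0 => /orP[/eqP xE|/eqP xE]; last by exfalso; lra.
have yE : y = y' by move: sE; rewrite xE => /addrI.
by rewrite xE yE; split; ring.
Qed.

Lemma self_similar_strip : exists u v len eps lam,
  [/\ strip q p' u v len, 0 < eps < 1, 1 < lam,
      forall z, exists2 z', q z' = eps * q z & p' z' = lam * p' z &
      forall z', exists2 z, q z' = eps * q z & p' z' = lam * p' z].
Proof.
have S := canonical_strip alpha01 irr; have q_inj := strip_inj S.
pose x0 : (int * int) * (int * int) := ((1, 0), (0, 1)).
have d_iter k : det2 (iter k (farey q) x0) = 1.
  elim: k => //= k; case: (iter k _ _) => [[u1 u2] [v1 v2]] <-.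
  by have [h|h] := fareyP; rewrite /det2 /=; ring.
pose m := Num.min (p (1, 0)) (p (0, 1)).
have m0 : 0 < m by rewrite lt_min (strip_pu S) (strip_pv S).
have i0 : straddles q p m x0.
  by split; rewrite ?(strip_qu S) ?(strip_qv S) // /m ge_min lexx ?orbT.
(* The difference of the two values of [q] starts at [1 + alpha] and never grows, so [q] stays below
   2 in absolute value. Hence [p > 2 |kappa|] makes [p' = p + kappa q] positive. *)
have [k [k1 k2]] := farey_unbounded q_inj m0 (`|kappa| * 2) i0.
have [x1 x2 _ _] := iter_farey_straddles q_inj m0 k i0.
have x12 : q (iter k (farey q) x0).2 - q (iter k (farey q) x0).1 < 2.
  have /andP[al0 al1] := alpha01.
  have q0 : q (0, 1) - q (1, 0) < 2 by rewrite !linE /=; lra.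
  case: (k) => [//|l]; apply: lt_trans q0.
  by have [] := iter_farey_lt q_inj m0 l i0.
have dx := d_iter k.
pose x := iter k (farey q) x0; rewrite -/x in k1 k2 x1 x2 x12 dx.
have kq y : - 2 < q y < 2 -> `|kappa * q y| <= `|kappa| * 2.
  by move=> qy; rewrite normrM ler_wpM2l // ler_norml; lra.
have px1 : 0 < p' x.1.
  have [|] := ler_normlP _ _ (kq x.1 _); first by lra.
  by rewrite conjugateE; lra.
have px2 : 0 < p' x.2.
  have [|] := ler_normlP _ _ (kq x.2 _); first by lra.
  by rewrite conjugateE; lra.
(* From here on [p'] takes the place of [p] in the growth lemmas. *)
have [m' m'0 ix] : exists2 m', 0 < m' & straddles q p' m' x.
  exists (Num.min (p' x.1) (p' x.2)); first by rewrite lt_min px1 px2.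
  by split; rewrite // ge_min lexx ?orbT.
have dxi i : det2 (iter i (farey q) x) = 1 by rewrite /x -iterD.
have ixi i : let y := iter i (farey q) x in
    [/\ q y.1 < 0 < q y.2, 0 < p' y.1 & 0 < p' y.2].
  move=> y; have [y1 y2 y3 y4] := iter_farey_straddles q_inj m'0 i ix.
  by split; [rewrite y1 y2|exact: lt_le_trans y3|exact: lt_le_trans y4].
have [l Hl] := indefinite_bounded (b * b - 4 * a * c).
have fl i : form_coefs a b c (iter i (farey q) x) \in l.
  case E : (form_coefs a b c _) => [[A B] C]; apply: Hl.
    have [] := ixi i; move: E; case: (iter i _ _) => u v.
    exact: straddles_form.
  by rewrite (form_disc E) dxi !mulr1.
(* All bases have determinant 1, so the discriminant is constant and the coefficients stay in the
   finite list [l]. *)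
have [i [j [ij fij]]] := pigeonhole_seq fl.
have [yq py1 py2] := ixi i; have [zq pz1 pz2] := ixi j.
have := iter_farey_lt q_inj m'0 (j - i).-1 (iter_farey_straddles q_inj m'0 i ix).
rewrite prednK ?subn_gt0 // -iterD subnK ?(ltnW ij) // => -[qlt plt].
have := dxi j; have := dxi i; move: fij yq py1 py2 zq pz1 pz2 qlt plt.
case: (iter i _ _) => u v; case: (iter j _ _) => u' v' /=.
move=> fij yq py1 py2 zq pz1 pz2 qlt plt dy dz.
have [qE pE] := form_coefs_ratio fij yq zq py1 py2 pz1 pz2.
have [/andP[qu qv] /andP[qu' qv']] := (yq, zq).
pose eps := q u' / q u; pose lam := p' u' / p' u.
have quE : q u' = eps * q u by rewrite divfK // lt_eqF.
have puE : p' u' = lam * p' u by rewrite divfK // gt_eqF.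
have qvE : q v' = eps * q v.
  apply: (mulIf (x := q u)); first by rewrite lt_eqF.
  by rewrite qE quE; ring.
have pvE : p' v' = lam * p' v.
  apply: (mulIf (x := p' u)); first by rewrite gt_eqF.
  by rewrite pE puE; ring.
exists u, v, (fun i => if i then p' v else p' u), eps, lam; split.
- by split=> // z; exact: det2_basis dy.
- apply/andP; split; first by rewrite /eps -mulrNN -invrN divr_gt0 // oppr_gt0.
  have w0 : 0 < q v - q u by lra.
  by rewrite -(ltr_pM2r w0) mul1r mulrBr -qvE -quE.
- have w0 : 0 < p' u + p' v by lra.
  by rewrite -(ltr_pM2r w0) mul1r mulrDr -pvE -puE.
(* The automorphism keeps the coordinates and replaces one basis by the other. *)
- move=> z; have [r [s zE]] := det2_basis z dy; exists (u' *~ r + v' *~ s).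
    by rewrite zE !raddfD !raddfMz quE qvE -!mulrzAr mulrDr.
  by rewrite zE !raddfD !raddfMz puE pvE -!mulrzAr mulrDr.
- move=> z; have [r [s zE]] := det2_basis z dz; exists (u *~ r + v *~ s).
    by rewrite zE !raddfD !raddfMz quE qvE -!mulrzAr mulrDr.
  by rewrite zE !raddfD !raddfMz puE pvE -!mulrzAr mulrDr.
Qed.

Lemma canonical_hull_substitution :
  is_substitution_tiling_space (hull (canonical_tiling alpha)).
Proof.
have [u [v [len [eps [lam [S e01 l1 sc unsc]]]]]] := self_similar_strip.
exists bool, len, (strip_substitution S e01 l1 sc),
  (strip_tiling p' u v len (halfspace q false) 0); split.
- exact: strip_primitive unsc.
- exact: strip_generated unsc.
rewrite (canonical_tilingE alpha01 irr).
have qd r : 0 < r -> exists z, 0 < q z < r.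
  by move=> r0; have [z ? _] := strip_contract S e01 l1 sc 0 r0; exists z.
(* The canonical cut is [halfspace q false] with [s = 0], so the conjugacy adds no translation to
   the base tiling. *)
have := strip_conjugate 0 (canonical_strip alpha01 irr) S qd (canonical_inj irr)
  conjugate_inj conjugateE (halfspace_cut q false).
by rewrite mulr0 addr0.
Qed.

End QuadraticSlope.

(** * Strong orbit equivalence and conclusion *)

Lemma strong_orbit_equivalent_refl (X : set biseq) : strong_orbit_equivalent X X.
Proof.
exists id, (fun=> 1); split.
- split; last by move=> s _; rewrite image_id.
  by exists id; split=> //; apply: continuous_subspaceT => x; exact: cvg_id.
- by move=> s _.
- by move=> s s' _ _ []; exact: filterE.
Qed.

Theorem corollary2 (R : realType) (alpha : R) (halpha : 0 < alpha < 1)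
    (hquad : quadratic_irrational alpha) :
  exists beta : R,
    [/\ 0 < beta < 1, irrational beta,
        strong_orbit_equivalent (sturmian_space alpha) (sturmian_space beta) &
        is_substitution_tiling_space (hull (canonical_tiling beta))].
Proof.
have [irr [a [b [c [a0 root]]]]] := hquad; exists alpha; split=> //.
- exact: strong_orbit_equivalent_refl.
- exact: canonical_hull_substitution a0 root.
Qed.
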